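(* Let $v\in(1,\infty)$ and $s\in\mathbb{Z}_+$. (i) If $w\in(1,v]$ and $Q_0\subsetneqq\mathbb{R}^n$ is a cube, then $hk_{(v,w,s)_{0}}(Q_0)=|Q_0|^{\frac1v-\frac1w}L^w(Q_0)$ with equivalent norms. (ii) $L^v(\mathbb{R}^n)=hk_{(v,v,s)_{0}}(\mathbb{R}^n)$ with equivalent norms. Here a function $h$ in the Lebesgue space $L^w(Q_0)$ (respectively $L^v(\mathbb{R}^n)$) is identified with the functional $f\mapsto\int hf$ on $jn_{(v',w',s)_0}(Q_0)$ (respectively on $jn_{(v',v',s)_0}(\mathbb{R}^n)$), where $1/v+1/v'=1=1/w+1/w'$.
   Context: $\mathbb{Z}_+=\{0,1,2,\dots\}$. A cube $Q\subset\mathbb{R}^n$ has edges parallel to the coordinate axes and finite positive side length $\ell(Q)$, and is not necessarily closed; $\ell(\mathbb{R}^n):=\infty$. Below $\mathcal{X}$ is $\mathbb{R}^n$ or a cube $Q_0\subsetneqq\mathbb{R}^n$. Functions are complex-valued, measurable and identified when equal almost everywhere. $\fint_Q f:=\frac1{|Q|}\int_Q f$. $L^q_{\mathrm{loc}}(\mathcal{X})$ is the set of measurable $f$ with $f\mathbf{1}_E\in L^q(\mathcal{X})$ for every bounded $E\subset\mathcal{X}$. For a constant $\lambda\ge0$ and a normed space $\mathbb{X}$, $\lambda\mathbb{X}$ denotes the space $\mathbb{X}$ equipped with $\lambda\|\cdot\|_{\mathbb{X}}$. For $f\in L^1(Q)$, $P^{(s)}_Q(f)$ is the unique polynomial on $Q$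 of degree at most $s$ with $\int_Q[f(x)-P^{(s)}_Q(f)(x)]x^\beta\,dx=0$ for all $\beta\in\mathbb{Z}_+^n$, $|\beta|\le s$. Fix $c_0\in(0,\ell(\mathcal{X}))$ (the same constant in all definitions below). Let $P^{(s)}_{Q,c_0}(f):=P^{(s)}_Q(f)$ if $\ell(Q)<c_0$ and $P^{(s)}_{Q,c_0}(f):=0$ if $\ell(Q)\ge c_0$. For $p\in(1,\infty)$, $q\in[1,\infty)$, $jn_{(p,q,s)_0}(\mathcal{X})$ is the set of all $f\in L^q_{\mathrm{loc}}(\mathcal{X})$ with $$\|f\|_{jn_{(p,q,s)_0}(\mathcal{X})}:=\sup\Big[\sum_{j}|Q_j|\Big\{\Big[\fint_{Q_j}|f-P^{(s)}_{Q_j,c_0}(f)|^q\Big]^{1/q}\Big\}^p\Big]^{1/p}<\infty,$$ the supremum being over all countable (finite or infinite) collections $\{Q_j\}_j$ of cubes in $\mathcal{X}$ with pairwise disjoint interiors. (It is known that, for $1<p\le q<\infty$, $jn_{(p,q,s)_0}(Q_0)=L^q(Q_0)$ as sets with equivalent norms, and $jn_{(p,p,s)_0}(\mathbb{R}^n)=L^p(\mathbb{R}^n)$ with equivalent norms, so the functionals above are well defined and bounded.) Local atoms: a function $a$ on $\mathbb{R}^n$ is a local $(v,w,s)_0$-atom supported in a cube $Q$ if $\{a\ne0\}\subset Q$; $\|a\|_{L^w(Q)}\le|Q|^{\frac1w-\frac1v}$; and, when $\ell(Q)<c_0$, $\int_Q a(x)x^\beta\,dx=0$ for all $\beta\in\mathbb{Z}_+^n$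 with $|\beta|\le s$. An atom supported in a cube of $\mathcal{X}$ acts on $f\in jn_{(v',w',s)_0}(\mathcal{X})$ by $f\mapsto\int_Q af$. The dual $(jn_{(v',w',s)_0}(\mathcal{X}))^*$ is equipped with the weak-$*$ topology. $\widetilde{hk}_{(v,w,s)_0}(\mathcal{X})$ is the set of all $g\in(jn_{(v',w',s)_0}(\mathcal{X}))^*$ of the form $g=\sum_j\lambda_ja_j$ (weak-$*$ convergence), where the $a_j$ are local $(v,w,s)_0$-atoms supported respectively in cubes $Q_j\subset\mathcal{X}$ with pairwise disjoint interiors (countably many), $\lambda_j\in\mathbb{C}$ and $\sum_j|\lambda_j|^v<\infty$; $\|g\|_{\widetilde{hk}_{(v,w,s)_0}(\mathcal{X})}:=\inf(\sum_j|\lambda_j|^v)^{1/v}$ over all such decompositions. $hk_{(v,w,s)_0}(\mathcal{X})$ is the set of all $g\in(jn_{(v',w',s)_0}(\mathcal{X}))^*$ such that $g=\sum_{i\in\mathbb{N}}g_i$ weak-$*$ with $g_i\in\widetilde{hk}_{(v,w,s)_0}(\mathcal{X})$ and $\sum_i\|g_i\|_{\widetilde{hk}_{(v,w,s)_0}(\mathcal{X})}<\infty$; its norm is $\inf\sum_i\|g_i\|_{\widetilde{hk}_{(v,w,s)_0}(\mathcal{X})}$ over all such decompositions. *)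

(* Defs.v *)
From HB Require Import structures.
From mathcomp Require Import all_boot all_order all_algebra.
From mathcomp Require Import -(notations) mpoly.
From mathcomp Require Import all_classical all_reals all_analysis.
From mathcomp Require Import complex.

Set Implicit Arguments.
Unset Strict Implicit.
Unset Printing Implicit Defensive.

Import Order.TTheory GRing.Theory Num.Theory numFieldNormedType.Exports.
Local Open Scope classical_set_scope.
Local Open Scope ring_scope.

Section LebesgueMeasure.
Context {R : realType}.

Section Cons.
Variables (n : nat) (mu : {sigma_finite_measure set (n.-tuple R) -> \bar R}).

Definition consT (p : measurableTypeR R * n.-tuple R) : n.+1.-tuple R :=
  [tuple of p.1 :: p.2].

Lemma measurable_consT : measurable_fun setT consT.
Proof. by apply: measurable_cons => //; exact: measurable_fst. Qed.

Definition cons_measure : set (n.+1.-tuple R) -> \bar R :=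
  pushforward (lebesgue_measure \x mu)%E consT.

Let cons0 : cons_measure set0 = 0%E.
Proof. by rewrite /cons_measure /pushforward preimage_set0 measure0. Qed.

Let cons_ge0 A : (0 <= cons_measure A)%E.
Proof. by rewrite /cons_measure /pushforward; exact: measure_ge0. Qed.

Let cons_sigma_additive : semi_sigma_additive cons_measure.
Proof.
have mT A : measurable A -> measurable (consT @^-1` A).
  by move=> mA; rewrite -[X in measurable X]setTI; exact: measurable_consT.
move=> F mF tF mUF; rewrite /cons_measure /pushforward preimage_bigcup.
apply: measure_semi_sigma_additive.
- by move=> k; exact: mT.
- apply/trivIsetP => /= i j _ _ ij; rewrite -preimage_setI.
  by move/trivIsetP : tF => /(_ _ _ _ _ ij) ->//; rewrite preimage_set0.
- by rewrite -preimage_bigcup; exact: mT.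
Qed.

HB.instance Definition _ := isMeasure.Build _ _ _
  cons_measure cons0 cons_ge0 cons_sigma_additive.

Let cons_sigma_finite : sigma_finite setT cons_measure.
Proof.
have /sigma_finiteP[F [TF ndF Foo]] := sigma_finiteT (@lebesgue_measure R).
have /sigma_finiteP[G [TG ndG Goo]] := sigma_finiteT mu.
pose u (t : n.+1.-tuple R) : measurableTypeR R * n.-tuple R :=
  (thead t, [tuple of behead t]).
have uK p : u (consT p) = p.
  by case: p => x t; rewrite /u /consT /= theadE; congr (_, _); exact/val_inj.
have mu' : measurable_fun setT u.
  apply/measurable_fun_pairP; split; first exact: measurable_tnth.
  exact: measurable_behead.
exists (fun i => u @^-1` (F i `*` G i)).
  apply/esym; rewrite -subTset => t _.
  have [i _ Fi] : (\bigcup_i F i) (thead t) by rewrite -TF.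
  have [j _ Gj] : (\bigcup_i G i) [tuple of behead t] by rewrite -TG.
  exists (maxn i j) => //; split => /=.
    by move: Fi; exact/subsetPset/ndF/leq_maxl.
  by move: Gj; exact/subsetPset/ndG/leq_maxr.
move=> i; have [mFi Fioo] := Foo i; have [mGi Gioo] := Goo i; split.
  by rewrite -[X in measurable X]setTI; apply: mu' => //; exact: measurableX.
rewrite /cons_measure /pushforward.
suff -> : consT @^-1` (u @^-1` (F i `*` G i)) = F i `*` G i.
  rewrite product_measure1E//.
  by rewrite lte_mul_pinfty// ge0_fin_numE.
by rewrite -comp_preimage (_ : u \o consT = id)//; apply/funext => p; exact: uK.
Qed.

HB.instance Definition _ :=
  Measure_isSigmaFinite.Build _ _ _ cons_measure cons_sigma_finite.

End Cons.

(* Lebesgue measure on the Borel sets of R^n; see leb_box. *)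
Fixpoint leb n : {sigma_finite_measure set (n.-tuple R) -> \bar R} :=
  match n with
  | 0 => dirac [tuple]
  | n.+1 => cons_measure (leb n)
  end.

Lemma measurable_box n (A : 'I_n -> set R) : (forall i, measurable (A i)) ->
  measurable [set x : n.-tuple R | forall i, A i (tnth x i)].
Proof.
move=> mA.
rewrite (_ : [set _ | _] =
    \bigcap_(i in [set: 'I_n]) ((@tnth n R)^~ i @^-1` A i)).
  apply: fin_bigcap_measurable => // i _.
  by rewrite -[X in measurable X]setTI; exact: measurable_tnth.
by apply/seteqP; split => x /= H i; [move=> _|]; exact: H.
Qed.

Lemma leb_box n (A : 'I_n -> set R) : (forall i, measurable (A i)) ->
  leb n [set x | forall i, A i (tnth x i)] =
  (\prod_i (lebesgue_measure (A i)))%E.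
Proof.
elim: n A => [|n IH] A mA /=.
  by rewrite big_ord0 /dirac /= indicE mem_set//= => -[].
rewrite big_ord_recl -IH; last by move=> i; exact: mA.
rewrite /cons_measure /pushforward.
rewrite (_ : _ @^-1` _ = A ord0 `*`
    [set x : n.-tuple R | forall i, A (lift ord0 i) (tnth x i)]).
  rewrite product_measure1E; [by []|exact: mA|].
  exact: (@measurable_box n (fun i => A (lift ord0 i))).
apply/seteqP; split => -[x t] /=.
  move=> H; split; first by have := H ord0; rewrite /tnth.
  by move=> i; have := H (lift ord0 i); rewrite /consT /= tnthS.
move=> [H1 H2] i; case: (unliftP ord0 i) => [j ->|->];
  rewrite /consT ?tnthS; last by [].
exact: H2.
Qed.

End LebesgueMeasure.

Section Spaces.
Context {R : realType} {n : nat}.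

Local Notation Rn := (n.-tuple R).
Local Notation mu := (@leb R n).
Local Notation normc := (@Normc.normc R).
Local Notation cRe := (@complex.Re R).
Local Notation cIm := (@complex.Im R).

Implicit Types (f h a : Rn -> R[i]) (X E : set Rn) (p q v w c : R) (s : nat).

(* The bits lbnd i and rbnd i are those of BSide: the i-th edge contains its
   left endpoint iff lbnd i = true, its right endpoint iff rbnd i = false. *)
Record cube := Cube {
  corner : Rn;
  side : R;
  lbnd : 'I_n -> bool;
  rbnd : 'I_n -> bool;
  side_gt0 : 0 < side }.

Definition cube_set (Q : cube) : set Rn := [set x | forall i,
  tnth x i \in Interval (BSide (lbnd Q i) (tnth (corner Q) i))
                        (BSide (rbnd Q i) (tnth (corner Q) i + side Q))].

Definition cube_interior (Q : cube) : set Rn := [set x | forall i,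
  tnth x i \in `]tnth (corner Q) i, (tnth (corner Q) i + side Q)[ ].

Definition vol (Q : cube) : R := fine (mu (cube_set Q)).

Lemma volE Q : vol Q = side Q ^+ n.
Proof.
rewrite /vol /cube_set.
have -> := @leb_box R n (fun i => [set` Interval
  (BSide (lbnd Q i) (tnth (corner Q) i))
  (BSide (rbnd Q i) (tnth (corner Q) i + side Q))]) (fun i => measurable_itv _).
rewrite (eq_bigr (fun=> (side Q)%:E)); first by rewrite prodEFin /= prodr_const card_ord.
move=> i _; rewrite lebesgue_measure_itv /= lte_fin ltrDl side_gt0 -EFinD.
by rewrite addrAC subrr add0r.
Qed.

Definition bounded_Rn E := exists M : R, forall x, E x -> forall i, `|tnth x i| <= M.

(* Borel measurability: every Lebesgue measurable function agrees almost
   everywhere with a Borel one. *)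
Definition cmeasurable X f :=
  measurable_fun X (cRe \o f) /\ measurable_fun X (cIm \o f).

Definition cintegrable X f :=
  mu.-integrable X (EFin \o cRe \o f) /\
  mu.-integrable X (EFin \o cIm \o f).

Definition cintegral X f : R[i] :=
  ((\int[mu]_(x in X) cRe (f x)) +i*
   (\int[mu]_(x in X) cIm (f x)))%C.

Definition Lnormc X q f : \bar R :=
  'N[mu]_(q%:E)[(fun x => (normc (f x))%:E) \_ X].

Definition Lqspace X q f := cmeasurable X f /\ (Lnormc X q f < +oo)%E.

(* Measurability of f 1_E forces the bounded sets E to be taken measurable. *)
Definition Lloc X q f := cmeasurable X f /\
  forall E, measurable E -> E `<=` X -> bounded_Rn E -> (Lnormc E q f < +oo)%E.

Definition cpoint (x : Rn) (i : 'I_n) : R[i] := (tnth x i)%:C%C.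

Definition monomial (b : multinom n) (x : Rn) : R[i] :=
  mmap1 (cpoint x) b.

Definition polyfun (P : mpoly.mpoly n R[i]) (x : Rn) : R[i] :=
  meval (cpoint x) P.

(* mmeasure mdeg P is 1 + the degree of P, or 0 if P = 0. *)
Definition is_moment_proj s (Q : cube) f (P : mpoly.mpoly n R[i]) :=
  (mmeasure mdeg P <= s.+1)%N /\
  forall b : multinom n, (mdeg b <= s)%N ->
    cintegral (cube_set Q) (fun x => (f x - polyfun P x) * monomial b x) = 0.

Definition moment_proj s Q f : mpoly.mpoly n R[i] :=
  xget 0 [set P | is_moment_proj s Q f P].

Definition local_moment_proj s c0 Q f : mpoly.mpoly n R[i] :=
  if side Q < c0 then moment_proj s Q f else 0.

(* A countable collection of cubes is a family indexed by a set D of natural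
   numbers. *)
Definition cube_family X (D : set nat) (Q : nat -> cube) :=
  (forall j, D j -> cube_set (Q j) `<=` X) /\
  trivIset D (fun j => cube_interior (Q j)).

Local Open Scope ereal_scope.

Definition mean_osc q s c0 f Q : \bar R :=
  ((vol Q)^-1%:E * \int[mu]_(x in cube_set Q)
     (normc (f x - polyfun (local_moment_proj s c0 Q f) x) `^ q)%:E)
  `^ q^-1.

Definition jn_norm p q s c0 X f : \bar R :=
  ereal_sup [set r | exists D Q, cube_family X D Q /\
    r = (\sum_(0 <= j <oo | j \in D)
           (vol (Q j))%:E * mean_osc q s c0 f (Q j) `^ p) `^ p^-1].

Definition jn p q s c0 X f := Lloc X q f /\ jn_norm p q s c0 X f < +oo.

(* Functionals on jn are total functions of which only the restriction to jn
   matters; bounded linear ones are constant on classes of a.e. equal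
   functions, as these differ by a function of norm 0. *)
Definition functional := (Rn -> R[i]) -> R[i].

Definition jn_dual p q s c0 X (g : functional) :=
  (forall (k : R[i]) f1 f2, jn p q s c0 X f1 -> jn p q s c0 X f2 ->
     g (fun x => k * f1 x + f2 x)%R = (k * g f1 + g f2)%R) /\
  exists M : R, forall f, jn p q s c0 X f ->
     (normc (g f))%:E <= M%:E * jn_norm p q s c0 X f.

(* g = \sum_(j in D) G j for the weak-* topology, i.e. pointwise on jn *)
Definition wstar_sum p q s c0 X (D : set nat) (G : nat -> functional)
    (g : functional) :=
  forall f, jn p q s c0 X f ->
    (fun N => \sum_(0 <= j < N | j \in D) G j f)%R @ \oo --> (g f : R[i]^o).

Definition pairing X h : functional := fun f => cintegral X (fun x => h x * f x)%R.

Definition conj_exp v : R := fine (hoelder_conjugate v%:E).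

Definition local_atom v w s c0 (Q : cube) a :=
  [/\ cmeasurable setT a,
      [set x | a x != 0%R] `<=` cube_set Q,
      Lnormc (cube_set Q) w a <= (vol Q `^ (w^-1 - v^-1))%:E
    & (side Q < c0)%R -> forall b : multinom n, (mdeg b <= s)%N ->
        cintegral (cube_set Q) (fun x => a x * monomial b x)%R = 0%R].

Definition atomic_decomp v w s c0 X (g : functional) (D : set nat)
    (lambda : nat -> R[i]) (a : nat -> Rn -> R[i]) (Q : nat -> cube) :=
  [/\ cube_family X D Q,
      (forall j, D j -> local_atom v w s c0 (Q j) (a j)),
      \sum_(0 <= j <oo | j \in D) (normc (lambda j) `^ v)%:E < +oo
    & wstar_sum (conj_exp v) (conj_exp w) s c0 X D
        (fun j f => lambda j * pairing (cube_set (Q j)) (a j) f)%R g].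

Definition hk_tilde v w s c0 X (g : functional) :=
  jn_dual (conj_exp v) (conj_exp w) s c0 X g /\
  exists D lambda (a : nat -> Rn -> R[i]) Q, atomic_decomp v w s c0 X g D lambda a Q.

Definition hk_tilde_norm v w s c0 X (g : functional) : \bar R :=
  ereal_inf [set r | exists D lambda (a : nat -> Rn -> R[i]) Q,
    atomic_decomp v w s c0 X g D lambda a Q /\
    r = (\sum_(0 <= j <oo | j \in D) (normc (lambda j) `^ v)%:E) `^ v^-1].

Definition hk_decomp v w s c0 X (g : functional) (G : nat -> functional) :=
  [/\ (forall i, hk_tilde v w s c0 X (G i)),
      \sum_(0 <= i <oo) hk_tilde_norm v w s c0 X (G i) < +oo
    & wstar_sum (conj_exp v) (conj_exp w) s c0 X setT G g].

Definition hk v w s c0 X (g : functional) :=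
  jn_dual (conj_exp v) (conj_exp w) s c0 X g /\
  exists G, hk_decomp v w s c0 X g G.

Definition hk_norm v w s c0 X (g : functional) : \bar R :=
  ereal_inf [set r | exists G, hk_decomp v w s c0 X g G /\
    r = \sum_(0 <= i <oo) hk_tilde_norm v w s c0 X (G i)].

(* hk_(v,w,s)_0(X) = lambda L^w(X), the norms being equivalent with constants
   c and C, when h in L^w(X) is identified with the functional pairing X h:
   these functionals are well defined, they are exactly the elements of hk
   (up to equality on jn), and the two norms are comparable. *)
Definition hk_equiv_Lebesgue v w s c0 X (lambda c C : R) :=
  [/\ (forall h f, Lqspace X w h -> jn (conj_exp v) (conj_exp w) s c0 X f ->
         cintegrable X (fun x => h x * f x)%R),
      (forall g, hk v w s c0 X g <-> exists2 h, Lqspace X w h &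
         forall f, jn (conj_exp v) (conj_exp w) s c0 X f -> g f = pairing X h f)
    & forall h, Lqspace X w h ->
        c%:E * (lambda%:E * Lnormc X w h) <= hk_norm v w s c0 X (pairing X h) /\
        hk_norm v w s c0 X (pairing X h) <= C%:E * (lambda%:E * Lnormc X w h)].

End Spaces.

Arguments cube : clear implicits.

(* Main.v *)
Require Import Defs.
From mathcomp Require Import all_boot all_order all_algebra.
From mathcomp Require Import -(notations) mpoly.
From mathcomp Require Import all_classical all_reals all_analysis.
From mathcomp Require Import measurable_realfun complex ring lra.

(* On L^q of a cube of side at least c0 the jn-norm dominates a multiple of the
   L^q-norm, since no polynomial is subtracted there; taking the cube Q0, or a
   grid of cubes of side c0 in R^n, shows that jn embeds into L^q.  Conversely
   L^q lies in jn: the moment projection P of f on Q is the L^2-projection, so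
   int_Q |P|^2 <= sup_Q |P| int_Q |f|, and |P| <= K fint_Q |P| on Q with K
   independent of Q, hence |P| <= K^2 fint_Q |f|.  Therefore jn = L^q as a set,
   and it separates the functions of L^w.

   The sum h of an atomic decomposition is a function with
   |Q0|^(1/v - 1/w) ||h||_w <= (sum_j |lambda_j|^v)^(1/v), by disjointness of the
   supports and Hölder's inequality for series; absolutely convergent series in L^w then
   represent the elements of hk.  For the converse, a function on Q0 is a multiple
   of a single atom, and a function on R^n is cut into atoms along the grid; the
   cubes used have side at least c0, so that no moment condition is required. *)

Set Implicit Arguments.
Unset Strict Implicit.
Unset Printing Implicit Defensive.

Import Order.TTheory GRing.Theory Num.Theory numFieldNormedType.Exports.
Local Open Scope classical_set_scope.
Local Open Scope ring_scope.

(** * Dilations of Lebesgue measure *)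

(** Both comparison constants are 1: a single factor [lam], equal to |Q0|^(1/v - 1/w) on a cube and
    to 1 on the space, governs the two directions. Since 1/v' - 1/w' = 1/w - 1/v, testing the
    jn-norm on Q0 alone bounds ||f||_(w') by lam ||f||_jn. An atom satisfies ||a||_w^w <= |Q|^(1 -
    w/v), and for w < v Hölder with exponents v/w and v/(v - w), applied to coefficients and
    volumes, produces lam^(-1).

    The constant K in |P| <= K fint_Q |P| has to serve all cubes at once, because the families in
    the jn-norm contain cubes of every size and position. It comes from one-variable interpolation:
    along a segment issuing from x, P has degree at most s, so P(x) is a fixed combination of the
    values at the nodes 1/(s+1), ..., 1. Dilating Lebesgue measure turns these values into averages
    over Q, and K depends on n and s only.

    The hk-norm is an infimum over decompositions, each with its own sum h. Pairing with conj(h)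
    |h|^(w-2), a function of L^(w'), shows that all these sums have the same L^w-norm. *)

Section Dilation.
Context {R : realType}.

(** By uniqueness of Lebesgue measure: [t] times its pushforward under the affine map gives every
    interval []x, y]] its length. *)
Lemma lebesgue_measure_affine (b t : R) (A : set (measurableTypeR R)) : 0 < t ->
  measurable A ->
  lebesgue_measure ((fun y => b + t * y) @^-1` A) =
  (t^-1%:E * lebesgue_measure A)%E.
Proof.
move=> t0 mA.
pose T (y : measurableTypeR R) : measurableTypeR R := b + t * y.
have mT : measurable_fun setT T.
  by apply: measurable_funD => //; exact: measurable_funM.
(* The measure structure of [pushforward] takes the measurability of [T] as an
   argument that unification cannot infer. *)
pose m : {measure set (measurableTypeR R) -> \bar R} :=
  measure_function_pushforward__canonical__measure_function_Measure
    (@lebesgue_measure R) mT.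
have H : forall X, measurable X ->
    lebesgue_measure X = mscale (NngNum (ltW t0)) m X.
  apply: lebesgue_measure_unique => // _ [[x y] _ <-].
  rewrite /mscale /= /pushforward.
  change (lebesgue_measure `]x, y]%classic =
    (t%:E * lebesgue_measure (T @^-1` `]x, y]%classic))%E).
  rewrite (_ : T @^-1` _ = `](x - b) / t, (y - b) / t]%classic); last first.
    apply/seteqP; split => z /=; rewrite !in_itv /= /T ltr_pdivrMr// ler_pdivlMr//;
      by rewrite ltrBlDl lerBrDl (mulrC z).
  rewrite !lebesgue_measure_itv /= !lte_fin ltr_pM2r ?invr_gt0// ltrD2r.
  case: ifPn => _; last by rewrite mule0.
  rewrite -!EFinD -EFinM; congr EFin; field; exact: lt0r_neq0.
rewrite [in RHS]H// /mscale.
change (lebesgue_measure (T @^-1` A) =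
  ((t^-1)%:E * (t%:E * lebesgue_measure (T @^-1` A)))%E).
by rewrite muleA -EFinM mulVf ?gt_eqF// mul1e.
Qed.

Definition affine n (b : n.-tuple R) (t : R) (y : n.-tuple R) : n.-tuple R :=
  [tuple tnth b i + t * tnth y i | i < n].

Lemma measurable_affine n (b : n.-tuple R) (t : R) :
  measurable_fun setT (affine b t).
Proof.
apply/measurable_fun_tnthP => i.
rewrite (_ : _ \o _ = (fun y => tnth b i + t * tnth y i)); last first.
  by apply/funext => y; rewrite /= tnth_mktuple.
apply: measurable_funD => //; apply: measurable_funM => //.
exact: measurable_tnth.
Qed.

(** Induction through sections: a section of the preimage is the preimage of a section, so the tail
    contributes [t ^- n] and the first coordinate one more [t^-1]. *)
Lemma leb_affine n (b : n.-tuple R) (t : R) (A : set (n.-tuple R)) : 0 < t ->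
  measurable A ->
  leb n (affine b t @^-1` A) = ((t ^- n)%:E * leb n A)%E.
Proof.
move=> t0; elim: n b A => [|n IH] b A mA.
  rewrite expr0 invr1 mul1e; congr (leb 0 _).
  by apply/seteqP; split => x /=; rewrite (tuple0 x) (tuple0 (affine _ _ _)).
rewrite /= /cons_measure /pushforward.
pose B := @consT R n @^-1` A.
have mB : measurable B.
  by rewrite -[B]setTI; exact: measurable_consT.
pose b' : n.-tuple R := [tuple of behead b].
pose T1 (y : measurableTypeR R) : measurableTypeR R := thead b + t * y.
have mT1 : measurable_fun setT T1.
  by apply: measurable_funD => //; exact: measurable_funM.
have -> : @consT R n @^-1` (affine b t @^-1` A) =
   (fun p => (T1 p.1, affine b' t p.2)) @^-1` B.
  apply/seteqP; split => -[x y] /=; rewrite /B /=.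
    rewrite (_ : affine b t _ = consT (T1 x, affine b' t y))//.
    apply: eq_from_tnth => i; rewrite tnth_mktuple /consT.
    case: (unliftP ord0 i) => [j ->|->]; rewrite ?tnthS /= ?tnth_mktuple //.
    by rewrite tnth_behead; congr (tnth b _ + _); apply: val_inj; rewrite /= inordK// ltnS.
  rewrite (_ : affine b t _ = consT (T1 x, affine b' t y))//.
  apply: eq_from_tnth => i; rewrite tnth_mktuple /consT.
  case: (unliftP ord0 i) => [j ->|->]; rewrite ?tnthS /= ?tnth_mktuple //.
  by rewrite tnth_behead; congr (tnth b _ + _); apply: val_inj; rewrite /= inordK// ltnS.
rewrite /product_measure1.
transitivity (\int[lebesgue_measure]_x ((t ^- n)%:E * leb n (xsection B (T1 x))))%E.
  apply: eq_integral => x _ /=.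
  rewrite -(IH b'); last exact: measurable_xsection.
  congr (leb n _); apply/seteqP; split => y; by rewrite /xsection /= !inE.
rewrite ge0_integralZl//; last 2 first.
- exact: (measurableT_comp (measurable_fun_xsection (leb n) mB) mT1).
- by rewrite lee_fin invr_ge0 exprn_ge0// ltW.
(* Change of variables in the first coordinate, as an integral against the pushforward under
   [T1]. *)
have -> : (\int[lebesgue_measure]_x leb n (xsection B (T1 x)) =
  \int[pushforward lebesgue_measure T1]_x leb n (xsection B x))%E.
  by rewrite ge0_integral_pushforward//; exact: measurable_fun_xsection.
have tV0 : 0 <= t^-1 by rewrite invr_ge0 ltW.
rewrite (@eq_measure_integral _ _ _ _ (mscale (NngNum tV0) lebesgue_measure)); last first.
  move=> C mC _; exact: lebesgue_measure_affine.
rewrite ge0_integral_mscale//; last exact: measurable_fun_xsection.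
by rewrite /= muleA -EFinM exprSr invfM mulrC.
Qed.

End Dilation.

(** * Complex-valued functions *)
Section ComplexNumbers.
Context {R : realType}.
Implicit Types x y z : R[i].
Local Notation normc := (@Normc.normc R).
Local Notation cRe := (@complex.Re R).
Local Notation cIm := (@complex.Im R).

Lemma Re_mulc x y : cRe (x * y) = cRe x * cRe y - cIm x * cIm y.
Proof. by case: x => a b; case: y. Qed.

Lemma Im_mulc x y : cIm (x * y) = cRe x * cIm y + cIm x * cRe y.
Proof. by case: x => a b; case: y. Qed.

Lemma ReD x y : cRe (x + y) = cRe x + cRe y.
Proof. by case: x => a b; case: y. Qed.

Lemma ImD x y : cIm (x + y) = cIm x + cIm y.
Proof. by case: x => a b; case: y. Qed.

Lemma ReN x : cRe (- x) = - cRe x. Proof. by case: x. Qed.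

Lemma ImN x : cIm (- x) = - cIm x. Proof. by case: x. Qed.

Lemma Re_sum I (r : seq I) (P : pred I) (F : I -> R[i]) :
  cRe (\sum_(i <- r | P i) F i) = \sum_(i <- r | P i) cRe (F i).
Proof. by apply: big_morph => // x y; exact: ReD. Qed.

Lemma Im_sum I (r : seq I) (P : pred I) (F : I -> R[i]) :
  cIm (\sum_(i <- r | P i) F i) = \sum_(i <- r | P i) cIm (F i).
Proof. by apply: big_morph => // x y; exact: ImD. Qed.

Lemma normcE z : normc z = Num.sqrt (cRe z ^+ 2 + cIm z ^+ 2).
Proof. by case: z. Qed.

Lemma normc_ge0 z : 0 <= normc z.
Proof. by rewrite normcE sqrtr_ge0. Qed.

Lemma normc_sqr z : normc z ^+ 2 = cRe z ^+ 2 + cIm z ^+ 2.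
Proof. by rewrite normcE sqr_sqrtr// addr_ge0// sqr_ge0. Qed.

Lemma Re_le_normc z : `|cRe z| <= normc z.
Proof.
by rewrite normcE -sqrtr_sqr ler_sqrt ?lerDl ?sqr_ge0// addr_ge0// sqr_ge0.
Qed.

Lemma Im_le_normc z : `|cIm z| <= normc z.
Proof.
by rewrite normcE -sqrtr_sqr ler_sqrt ?lerDr ?sqr_ge0// addr_ge0// sqr_ge0.
Qed.

Lemma normc_le_ReIm z : normc z <= `|cRe z| + `|cIm z|.
Proof.
rewrite -(@ler_pXn2r _ 2) ?nnegrE ?addr_ge0 ?normc_ge0 ?normr_ge0//.
rewrite normc_sqr -[cRe z ^+ 2]real_normK ?num_real// -[cIm z ^+ 2]real_normK ?num_real//.
rewrite sqrrD lerD2r lerDl mulrn_wge0// mulr_ge0//.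
Qed.

Lemma normc_real (a : R) : normc a%:C%C = `|a|.
Proof. by rewrite normcE /= expr0n addr0 sqrtr_sqr. Qed.

Lemma normc_conj z : normc z^*%C = normc z.
Proof. by case: z => a b; rewrite !normcE /= sqrrN. Qed.

Lemma normc_sum I (r : seq I) (P : pred I) (F : I -> R[i]) :
  normc (\sum_(i <- r | P i) F i) <= \sum_(i <- r | P i) normc (F i).
Proof.
elim/big_ind2 : _ => // [|x a y b xa yb]; first by rewrite Normc.normc0.
by rewrite (le_trans (le_normcD _ _))// lerD.
Qed.

Lemma normcXn z k : normc (z ^+ k) = normc z ^+ k.
Proof.
by elim: k => [|k IH]; rewrite ?expr0 ?Normc.normc1// !exprS Normc.normcM IH.
Qed.

Lemma ReM_conj z : cRe (z * z^*%C) = normc z ^+ 2.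
Proof. by rewrite normc_sqr; case: z => a b; rewrite /=; ring. Qed.

End ComplexNumbers.

Section ComplexMeasurability.
Context {R : realType} {n : nat}.
Local Notation Rn := (n.-tuple R).
Local Notation mu := (@leb R n).
Local Notation normc := (@Normc.normc R).
Local Notation cRe := (@complex.Re R).
Local Notation cIm := (@complex.Im R).
Implicit Types (f g : Rn -> R[i]) (X : set Rn).

Lemma cmeasurable_cst X (z : R[i]) : cmeasurable X (fun=> z).
Proof. by split; exact: measurable_cst. Qed.

Lemma cmeasurableD X f g : cmeasurable X f -> cmeasurable X g ->
  cmeasurable X (fun x => f x + g x).
Proof.
move=> [f1 f2] [g1 g2]; split.
- by rewrite (_ : _ \o _ = (cRe \o f) \+ (cRe \o g)); [exact: measurable_funD|
    apply/funext => x /=; rewrite ReD].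
- by rewrite (_ : _ \o _ = (cIm \o f) \+ (cIm \o g)); [exact: measurable_funD|
    apply/funext => x /=; rewrite ImD].
Qed.

Lemma cmeasurableM X f g : cmeasurable X f -> cmeasurable X g ->
  cmeasurable X (fun x => f x * g x).
Proof.
move=> [f1 f2] [g1 g2]; split.
- rewrite (_ : _ \o _ = ((cRe \o f) \* (cRe \o g)) \- ((cIm \o f) \* (cIm \o g))).
    by apply: measurable_funB; exact: measurable_funM.
  by apply/funext => x /=; rewrite Re_mulc.
- rewrite (_ : _ \o _ = ((cRe \o f) \* (cIm \o g)) \+ ((cIm \o f) \* (cRe \o g))).
    by apply: measurable_funD; exact: measurable_funM.
  by apply/funext => x /=; rewrite Im_mulc.
Qed.

Lemma cmeasurableN X f : cmeasurable X f -> cmeasurable X (fun x => - f x).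
Proof.
move=> mf; rewrite (_ : (fun _ => _) = (fun x => (-1) * f x)).
  by apply: cmeasurableM => //; exact: cmeasurable_cst.
by apply/funext => x; rewrite mulN1r.
Qed.

Lemma cmeasurableB X f g : cmeasurable X f -> cmeasurable X g ->
  cmeasurable X (fun x => f x - g x).
Proof. by move=> mf mg; apply: cmeasurableD => //; exact: cmeasurableN. Qed.

Lemma cmeasurable_conj X f : cmeasurable X f -> cmeasurable X (fun x => (f x)^*%C).
Proof.
move=> [f1 f2]; split.
- by rewrite (_ : _ \o _ = cRe \o f)//; apply/funext => x /=; case: (f x).
- rewrite (_ : _ \o _ = -%R \o (cIm \o f)); first exact: measurableT_comp.
  by apply/funext => x /=; case: (f x).
Qed.

Lemma cmeasurable_real X (u : Rn -> R) : measurable_fun X u ->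
  cmeasurable X (fun x => (u x)%:C%C).
Proof. by move=> mu; split => //; exact: measurable_cst. Qed.

Lemma cmeasurable_sum X I (r : seq I) (P : pred I) (F : I -> Rn -> R[i]) :
  (forall i, P i -> cmeasurable X (F i)) ->
  cmeasurable X (fun x => \sum_(i <- r | P i) F i x).
Proof.
move=> mF; elim: r => [|i r IH].
  rewrite (_ : (fun _ => _) = (fun=> 0)); first exact: cmeasurable_cst.
  by apply/funext => x; rewrite big_nil.
case: (boolP (P i)) => Pi.
  rewrite (_ : (fun _ => _) = (fun x => F i x + \sum_(j <- r | P j) F j x)).
    by apply: cmeasurableD => //; exact: mF.
  by apply/funext => x; rewrite big_cons Pi.
rewrite (_ : (fun _ => _) = (fun x => \sum_(j <- r | P j) F j x))//.
by apply/funext => x; rewrite big_cons (negbTE Pi).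
Qed.

Lemma cmeasurable_prod X I (r : seq I) (P : pred I) (F : I -> Rn -> R[i]) :
  (forall i, P i -> cmeasurable X (F i)) ->
  cmeasurable X (fun x => \prod_(i <- r | P i) F i x).
Proof.
move=> mF; elim: r => [|i r IH].
  rewrite (_ : (fun _ => _) = (fun=> 1)); first exact: cmeasurable_cst.
  by apply/funext => x; rewrite big_nil.
case: (boolP (P i)) => Pi.
  rewrite (_ : (fun _ => _) = (fun x => F i x * \prod_(j <- r | P j) F j x)).
    by apply: cmeasurableM => //; exact: mF.
  by apply/funext => x; rewrite big_cons Pi.
rewrite (_ : (fun _ => _) = (fun x => \prod_(j <- r | P j) F j x))//.
by apply/funext => x; rewrite big_cons (negbTE Pi).
Qed.

Lemma cmeasurableX X f k : cmeasurable X f -> cmeasurable X (fun x => f x ^+ k).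
Proof.
move=> mf; elim: k => [|k IH].
  rewrite (_ : (fun _ => _) = (fun=> 1)); first exact: cmeasurable_cst.
  by apply/funext => x; rewrite expr0.
rewrite (_ : (fun _ => _) = (fun x => f x * f x ^+ k)); first exact: cmeasurableM.
by apply/funext => x; rewrite exprS.
Qed.

Lemma measurable_normc X f : cmeasurable X f ->
  measurable_fun X (fun x => normc (f x)).
Proof.
move=> [f1 f2].
rewrite (_ : (fun _ => _) =
    (@Num.sqrt R) \o ((fun x => cRe (f x) ^+ 2) \+ (fun x => cIm (f x) ^+ 2))).
  apply: measurableT_comp; last first.
    by apply: measurable_funD; exact: (measurable_funX 2).
  by apply: continuous_measurable_fun => x; exact: sqrt_continuous.
by apply/funext => x /=; rewrite normcE.
Qed.

Lemma measurable_EFin_normc X f : cmeasurable X f ->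
  measurable_fun X (fun x => (normc (f x))%:E).
Proof. by move=> mf; apply/measurable_EFinP; exact: measurable_normc. Qed.

Lemma cmeasurableS X Y f : measurable Y -> X `<=` Y -> cmeasurable Y f -> cmeasurable X f.
Proof. by move=> mY XY [f1 f2]; split; exact: (measurable_funS mY XY). Qed.

(** The modulus dominates |Re| and |Im| and is at most their sum, so one bound on its integral
    replaces two real conditions. *)
Lemma cintegrableP X f : measurable X -> cintegrable X f <->
  cmeasurable X f /\ (\int[mu]_(x in X) (normc (f x))%:E < +oo)%E.
Proof.
move=> mX; split=> [[/integrableP[m1 i1] /integrableP[m2 i2]]|[[m1 m2] i]].
  have mf : cmeasurable X f by split; exact/measurable_EFinP.
  split=> //.
  apply: (@le_lt_trans _ _ (\int[mu]_(x in X) ((`|cRe (f x)|)%:E + (`|cIm (f x)|)%:E)))%E.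
    apply: ge0_le_integral => //.
    - by move=> x _; rewrite lee_fin normc_ge0.
    - exact: measurable_EFin_normc.
    - by apply/measurable_EFinP/measurable_funD; apply: measurableT_comp => //;
        case: mf.
    - by move=> x _; rewrite -EFinD lee_fin normc_le_ReIm.
  rewrite ge0_integralD//; first exact: lte_add_pinfty.
  - by apply/measurable_EFinP; apply: measurableT_comp => //; case: mf.
  - by apply/measurable_EFinP; apply: measurableT_comp => //; case: mf.
split; apply/integrableP; split; try exact/measurable_EFinP.
- apply: le_lt_trans i; apply: ge0_le_integral => //.
  + by apply/measurable_EFinP; apply: measurableT_comp.
  + by apply: measurable_EFin_normc; split.
  + by move=> x _; rewrite lee_fin Re_le_normc.
- apply: le_lt_trans i; apply: ge0_le_integral => //.
  + by apply/measurable_EFinP; apply: measurableT_comp.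
  + by apply: measurable_EFin_normc; split.
  + by move=> x _; rewrite lee_fin Im_le_normc.
Qed.

Lemma cintegrable_le X f (g : Rn -> R) : measurable X -> cmeasurable X f ->
  measurable_fun X g -> (forall x, X x -> normc (f x) <= g x) ->
  (\int[mu]_(x in X) (g x)%:E < +oo)%E -> cintegrable X f.
Proof.
move=> mX mf mg fg ig; apply/cintegrableP => //; split => //.
apply: le_lt_trans ig; apply: ge0_le_integral => //.
- by move=> x _; rewrite lee_fin normc_ge0.
- exact: measurable_EFin_normc.
- by apply/measurable_EFinP.
Qed.

Lemma cintegralD X f g : measurable X -> cintegrable X f -> cintegrable X g ->
  cintegral X (fun x => f x + g x) = cintegral X f + cintegral X g.
Proof.
move=> mX [f1 f2] [g1 g2]; rewrite /cintegral.
rewrite (_ : (\int[mu]_(x in X) cRe (f x + g x)) =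
  \int[mu]_(x in X) cRe (f x) + \int[mu]_(x in X) cRe (g x)).
  rewrite (_ : (\int[mu]_(x in X) cIm (f x + g x)) =
    \int[mu]_(x in X) cIm (f x) + \int[mu]_(x in X) cIm (g x))//.
  by under eq_Rintegral do rewrite ImD; rewrite RintegralD.
by under eq_Rintegral do rewrite ReD; rewrite RintegralD.
Qed.

Lemma cintegrableD X f g : measurable X -> cintegrable X f -> cintegrable X g ->
  cintegrable X (fun x => f x + g x).
Proof.
move=> mX [f1 f2] [g1 g2]; split.
- have := integrableD mX f1 g1; apply: eq_integrable => // x _.
  by rewrite /= -EFinD ReD.
- have := integrableD mX f2 g2; apply: eq_integrable => // x _.
  by rewrite /= -EFinD ImD.
Qed.

Lemma cintegrableZ X (k : R[i]) f : measurable X -> cintegrable X f ->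
  cintegrable X (fun x => k * f x).
Proof.
move=> mX /cintegrableP-/(_ mX)[mf i].
apply/cintegrableP => //; split.
  by apply: cmeasurableM => //; exact: cmeasurable_cst.
rewrite (_ : (\int[mu]_(x in X) _ = \int[mu]_(x in X) ((normc k)%:E * (normc (f x))%:E))%E).
  rewrite ge0_integralZl//.
  - by rewrite lte_mul_pinfty// lee_fin normc_ge0.
  - exact: measurable_EFin_normc.
  - by move=> x _; rewrite lee_fin normc_ge0.
  - by rewrite lee_fin normc_ge0.
by apply: eq_integral => x _; rewrite Normc.normcM EFinM.
Qed.

Lemma cintegralZ X (k : R[i]) f : measurable X -> cintegrable X f ->
  cintegral X (fun x => k * f x) = k * cintegral X f.
Proof.
move=> mX [f1 f2]; case: k => a b; rewrite /cintegral.
have Zi c (u : Rn -> R) : mu.-integrable X (EFin \o u) ->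
    mu.-integrable X (EFin \o (fun x => c * u x)).
  move=> iu; have := integrableZl mX c iu; apply: eq_integrable => //.
have -> : \int[mu]_(x in X) cRe ((a +i* b)%C * f x) =
   a * (\int[mu]_(x in X) cRe (f x)) - b * (\int[mu]_(x in X) cIm (f x)).
  under eq_Rintegral do rewrite Re_mulc /=.
  by rewrite RintegralB ?RintegralZl//; exact: Zi.
have -> : \int[mu]_(x in X) cIm ((a +i* b)%C * f x) =
   a * (\int[mu]_(x in X) cIm (f x)) + b * (\int[mu]_(x in X) cRe (f x)).
  under eq_Rintegral do rewrite Im_mulc /=.
  by rewrite RintegralD ?RintegralZl//; exact: Zi.
by [].
Qed.

Lemma cintegral_sum X (I : eqType) (r : seq I) (F : I -> Rn -> R[i]) : measurable X ->
  (forall i, i \in r -> cintegrable X (F i)) ->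
  cintegrable X (fun x => \sum_(i <- r) F i x) /\
  cintegral X (fun x => \sum_(i <- r) F i x) = \sum_(i <- r) cintegral X (F i).
Proof.
move=> mX; elim: r => [|i r IH] iF.
  rewrite (_ : (fun _ => _) = (fun=> 0)); last by apply/funext => x; rewrite big_nil.
  rewrite big_nil; split; first by split; exact: integrable0.
  by rewrite /cintegral /= !Rintegral_cst// !mul0r.
rewrite (_ : (fun _ => _) = (fun x => F i x + \sum_(j <- r) F j x)); last first.
  by apply/funext => x; rewrite big_cons.
have iFi : cintegrable X (F i) by apply: iF; rewrite mem_head.
have [ir er] := IH (fun j jr => iF j (mem_behead (s := i :: r) jr)).
split; first exact: cintegrableD.
by rewrite big_cons cintegralD// er.
Qed.

End ComplexMeasurability.

(** * Cubes and polynomials *)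

Section Cubes.
Context {R : realType} {n : nat}.
Local Notation Rn := (n.-tuple R).
Local Notation mu := (@leb R n).
Implicit Types Q : cube R n.

Lemma measurable_cube Q : measurable (cube_set Q).
Proof.
by apply: (@measurable_box R n (fun i => [set` Interval _ _])) => i;
  exact: measurable_itv.
Qed.

Lemma measurable_cube_interior Q : measurable (cube_interior Q).
Proof.
by apply: (@measurable_box R n (fun i => [set` Interval _ _])) => i;
  exact: measurable_itv.
Qed.

(** The endpoint bits are free so that one computation covers cubes of every kind and their
    interiors; the equality of these volumes makes boundaries null. *)
Lemma leb_interval_box Q (l r : 'I_n -> bool) :
  mu [set x | forall i, tnth x i \in Interval (BSide (l i) (tnth (corner Q) i))
    (BSide (r i) (tnth (corner Q) i + side Q))] = (side Q ^+ n)%:E.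
Proof.
have -> := @leb_box R n (fun i => [set` Interval
  (BSide (l i) (tnth (corner Q) i))
  (BSide (r i) (tnth (corner Q) i + side Q))]) (fun i => measurable_itv _).
rewrite (eq_bigr (fun=> (side Q)%:E)); first by rewrite prodEFin /= prodr_const card_ord.
move=> i _; rewrite lebesgue_measure_itv /= lte_fin ltrDl side_gt0 -EFinD.
by rewrite addrAC subrr add0r.
Qed.

Lemma leb_cube Q : mu (cube_set Q) = (vol Q)%:E.
Proof. by rewrite volE /cube_set leb_interval_box. Qed.

(* [leb_cube], for the coercion path through [measure]: the two sides of this
   equation print alike but rewriting distinguishes them. *)
Lemma leb_cubeE Q : (mu : {measure set Rn -> \bar R}) (cube_set Q) = (vol Q)%:E.
Proof. exact: leb_cube. Qed.

Lemma leb_cube_interior Q : mu (cube_interior Q) = (vol Q)%:E.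
Proof. by rewrite volE (leb_interval_box Q (fun=> false) (fun=> true)). Qed.

Lemma vol_gt0 Q : 0 < vol Q.
Proof. by rewrite volE exprn_gt0// side_gt0. Qed.

Lemma cube_interior_sub Q : cube_interior Q `<=` cube_set Q.
Proof.
move=> x Qx i; have := Qx i.
by apply: subitvP; rewrite subitvE !bnd_simp /=; case: (lbnd Q i); case: (rbnd Q i).
Qed.

(** Families of cubes are disjoint only in their interiors; this fact lets integrals over a cube be
    taken over its interior. *)
Lemma leb_cube_boundary Q : mu (cube_set Q `\` cube_interior Q) = 0%E.
Proof.
rewrite measureD; [|exact: measurable_cube|exact: measurable_cube_interior|].
  have /setIidPr -> := @cube_interior_sub Q.
  transitivity ((vol Q)%:E - (vol Q)%:E)%E; last by rewrite -EFinB subrr.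
  by congr (_ - _)%E; [exact: leb_cube|exact: leb_cube_interior].
by have := ltry (vol Q); rewrite -(leb_cube Q).
Qed.

Lemma cube_coordE Q (x : Rn) i : cube_set Q x ->
  tnth (corner Q) i <= tnth x i <= tnth (corner Q) i + side Q.
Proof.
move=> /(_ i); rewrite in_itv /=.
by case: (lbnd Q i); case: (rbnd Q i) => /andP[/= ? ?]; apply/andP; split => //; apply: ltW.
Qed.

Lemma bounded_cube Q : bounded_Rn (cube_set Q).
Proof.
exists (\sum_i `|tnth (corner Q) i| + side Q) => x Qx i.
have /andP[x1 x2] := cube_coordE i Qx.
have S : `|tnth (corner Q) i| <= \sum_i `|tnth (corner Q) i|.
  by rewrite (bigD1 i)//= lerDl sumr_ge0.
have := side_gt0 Q; have := ler_norm (tnth (corner Q) i).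
have := lerNnormlW (lexx `|tnth (corner Q) i|).
rewrite ler_norml; lra.
Qed.

(** Centre [x] and ratio [t], written through [affine] so that [leb_affine] applies. *)
Definition homothety (x : Rn) (t : R) : Rn -> Rn :=
  affine [tuple (1 - t) * tnth x i | i < n] t.

Lemma homothetyE x t y i :
  tnth (homothety x t y) i = (1 - t) * tnth x i + t * tnth y i.
Proof. by rewrite !tnth_mktuple. Qed.

Lemma homothety_cube Q x y t : 0 < t -> t <= 1 -> cube_set Q x -> cube_set Q y ->
  cube_set Q (homothety x t y).
Proof.
move=> t0 t1 Qx Qy i; have := Qx i; have := Qy i.
rewrite homothetyE; move: (tnth x i) (tnth y i) => a b.
move: (tnth (corner Q) i) => c; move: (c + side Q) => d.
rewrite !in_itv /=.
case: (lbnd Q i); case: (rbnd Q i) => /= /andP[h1 h2] /andP[h3 h4];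
  apply/andP; split; nra.
Qed.

(** By convexity [Q] lies in its preimage under the homothety. Enlarging the domain to this preimage
    makes the change of variables exact, with factor [t ^- n]. *)
Lemma integral_homothety_le Q x t (F : Rn -> \bar R) : 0 < t -> t <= 1 ->
  cube_set Q x -> measurable_fun setT F -> (forall y, 0 <= F y)%E ->
  (\int[mu]_(y in cube_set Q) F (homothety x t y) <=
   (t ^- n)%:E * \int[mu]_(y in cube_set Q) F y)%E.
Proof.
move=> t0 t1 Qx mF F0.
have mT : measurable_fun setT (homothety x t) by exact: measurable_affine.
have mTQ : measurable (homothety x t @^-1` cube_set Q).
  by rewrite -[X in measurable X]setTI; apply: mT => //; exact: measurable_cube.
apply: (@le_trans _ _ (\int[mu]_(y in homothety x t @^-1` cube_set Q) (F \o homothety x t) y)%E).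
  apply: ge0_subset_integral => //.
  - exact: measurable_cube.
  - by apply: measurable_funTS; exact: measurableT_comp.
  - by move=> y Qy; exact: homothety_cube.
rewrite -ge0_integral_pushforward//; last 2 first.
- exact: measurable_cube.
- exact: measurable_funTS.
have tn0 : 0 <= t ^- n by rewrite invr_ge0 exprn_ge0// ltW.
rewrite (@eq_measure_integral _ _ _ _ (mscale (NngNum tn0) mu)); last first.
  by move=> A mA _; exact: leb_affine.
rewrite ge0_integral_mscale//; first exact: measurable_cube.
exact: measurable_funTS.
Qed.

End Cubes.

(** * Polynomials on cubes and along segments *)

Section Polynomials.
Context {R : realType} {n : nat}.
Local Notation Rn := (n.-tuple R).
Local Notation normc := (@Normc.normc R).
Implicit Types (Q : cube R n) (P : mpoly.mpoly n R[i]).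

Lemma polyfunE P x : polyfun P x = \sum_(m <- msupp P) mcoeff m P * monomial m x.
Proof. by []. Qed.

Lemma cmeasurable_cpoint X (i : 'I_n) : cmeasurable X (fun x : Rn => Defs.cpoint x i).
Proof.
apply: cmeasurable_real; apply: measurable_funTS; exact: measurable_tnth.
Qed.

Lemma cmeasurable_monomial X (m : multinom n) : cmeasurable X (@monomial R n m).
Proof.
apply: cmeasurable_prod => i _; apply: cmeasurableX; exact: cmeasurable_cpoint.
Qed.

Lemma cmeasurable_polyfun X P : cmeasurable X (polyfun P).
Proof.
apply: cmeasurable_sum => m _; apply: cmeasurableM; first exact: cmeasurable_cst.
exact: cmeasurable_monomial.
Qed.

Lemma polyfun0 x : polyfun (0 : mpoly.mpoly n R[i]) x = 0.
Proof. by rewrite /polyfun meval0. Qed.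

Lemma monomial_real (m : multinom n) (x : Rn) : (monomial m x)^*%C = monomial m x.
Proof.
rewrite /monomial /mmap1 rmorph_prod; apply: eq_bigr => i _.
rewrite rmorphXn /=; congr (_ ^+ _); exact: conjc_real.
Qed.

Lemma polyfun_bounded P Q : exists2 M : R, 0 <= M &
  forall x, cube_set Q x -> normc (polyfun P x) <= M.
Proof.
have [B HB] := bounded_cube Q.
exists (\sum_(m <- msupp P) normc (mcoeff m P) * \prod_(i < n) `|B| ^+ (m i)).
  apply: sumr_ge0 => m _; rewrite mulr_ge0 ?normc_ge0// prodr_ge0//.
move=> x Qx; rewrite polyfunE; apply: (le_trans (normc_sum _ _ _)).
apply: ler_sum => m _; rewrite Normc.normcM ler_wpM2l ?normc_ge0//.
rewrite /monomial /mmap1.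
have -> : normc (\prod_(i < n) Defs.cpoint x i ^+ m i) = \prod_(i < n) `|tnth x i| ^+ m i.
  rewrite (big_morph normc (id1 := 1) (op1 := *%R)) //.
  - by apply: eq_bigr => i _; rewrite normcXn normc_real.
  - exact: Normc.normcM.
  - exact: Normc.normc1.
apply: ler_prod => i _; rewrite exprn_ge0//= lerXn2r ?nnegrE//.
by rewrite (le_trans (HB _ Qx i))// ler_norm.
Qed.

(** The nodes are distinct, so their Vandermonde matrix is invertible. They lie in ]0, 1] because
    they will be ratios of homotheties: positive ones can be inverted, and ratios at most 1 keep a
    cube inside itself. *)
Lemma interpolation_at_0 (F : numFieldType) (s : nat) : exists c : 'I_s.+1 -> F,
  forall p : {poly F}, (size p <= s.+1)%N ->
  p.[0] = \sum_k c k * p.[(k : nat).+1%:R / s.+1%:R].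
Proof.
pose a : 'rV[F]_s.+1 := \row_k ((k : nat).+1%:R / s.+1%:R).
pose V := Vandermonde s.+1 a.
have V_unit : V \in unitmx.
  rewrite unitmxE det_Vandermonde unitfE; apply/prodf_neq0 => i _.
  apply/prodf_neq0 => j ij; rewrite !mxE -mulrBl mulf_neq0 ?invr_eq0 ?pnatr_eq0//.
  by rewrite subr_eq0 eqr_nat eqSS gtn_eqF.
(* The first column of the inverse: the sum over k of [c k] times the i-th power of node k is 1 for
   i = 0 and 0 for 0 < i <= s. *)
pose c := invmx V *m delta_mx ord0 (ord0 : 'I_1).
have Hc : V *m c = delta_mx ord0 ord0 by rewrite mulmxA mulmxV// mul1mx.
exists (fun k => c k ord0) => p sp.
transitivity (\sum_(i < s.+1) p`_i * (\sum_k V i k * c k ord0)).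
  rewrite (eq_bigr (fun i : 'I_s.+1 => if i == ord0 then p`_0 else 0)).
    by rewrite -big_mkcond big_pred1_eq horner_coef0.
  move=> i _; have := congr1 (fun M : 'cV_s.+1 => M i ord0) Hc.
  rewrite !mxE => ->; rewrite eqxx andbT.
  by case: eqP => [->|]; rewrite ?mulr1 ?mulr0.
under eq_bigr do rewrite mulr_sumr.
rewrite exchange_big /=; apply: eq_bigr => k _.
rewrite (horner_coef_wide _ sp) mulr_sumr; apply: eq_bigr => i _.
by rewrite !mxE; ring.
Qed.

(** Replacing the i-th coordinate by the affine form [l i] turns a monomial [m] into a product of
    [mdeg m] factors of size at most 2, hence of size at most [(mdeg m).+1]. *)
Lemma polyfun_line P (s : nat) : (mmeasure mdeg P <= s.+1)%N ->
  forall x y : Rn, exists2 p : {poly R[i]}, (size p <= s.+1)%N &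
  forall t : R, p.[t%:C%C] = polyfun P (homothety x t y).
Proof.
move=> degP x y.
pose l i : {poly R[i]} :=
  (Defs.cpoint x i)%:P + (Defs.cpoint y i - Defs.cpoint x i) *: 'X.
exists (\sum_(m <- msupp P) mcoeff m P *: \prod_(i < n) l i ^+ m i).
  rewrite (leq_trans (size_sum _ _ _))// big_tnth; apply/bigmax_leqP => j _.
  have mP := mem_tnth j (in_tuple (msupp P)); move: (tnth _ _) mP => m mP.
  rewrite (leq_trans (size_scale_leq _ _))//.
  have : (size (\prod_(i < n) l i ^+ m i)%R <= (mdeg m).+1)%N.
    rewrite mdegE; elim/big_ind2 : _ => [|k p k' q kp kq|i _].
    - by rewrite size_poly1.
    - rewrite (leq_trans (size_polyMleq _ _))//.
      by rewrite -subn1 leq_subLR (leq_trans (leq_add kp kq))// addSn addnS add1n.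
    - have l2 : (size (l i) <= 2)%N.
        rewrite (leq_trans (size_polyD _ _))// geq_max (leq_trans (size_polyC_leq1 _))//=.
        by rewrite (leq_trans (size_scale_leq _ _))// size_polyX.
      rewrite (leq_trans (size_poly_exp_leq _ _))// ltnS.
      by rewrite -[leqRHS]mul1n leq_mul2r; case: (size (l i)) l2 => [|[|[|]]]; rewrite ?orbT.
  by move=> /leq_trans; apply; rewrite (leq_trans _ degP)// mmeasure_mnm_lt.
move=> t; rewrite polyfunE horner_sum; apply: eq_bigr => m _.
rewrite hornerZ horner_prod; congr (_ * _); apply: eq_bigr => i _.
rewrite horner_exp; congr (_ ^+ _); rewrite /l !hornerE /Defs.cpoint homothetyE.
by rewrite rmorphD !rmorphM rmorphB /=; ring.
Qed.

End Polynomials.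

(** * Hölder's inequality and moment projections *)

Section LebesgueNorms.
Context d (T : measurableType d) {R : realType}.
Variable mu : {measure set T -> \bar R}.
Implicit Types (X : set T) (u g : T -> R).

(** For nonzero [r] the power of 0 is 0, so the extension by zero contributes nothing off [X]. *)
Lemma Lnorm_patch X u r : r != 0 ->
  ('N[mu]_(r%:E)[(EFin \o u) \_ X] =
  (\int[mu]_(x in X) (`|u x| `^ r)%:E) `^ r^-1)%E.
Proof.
move=> r0; rewrite unlock; congr (_ `^ _)%E.
rewrite [RHS]integral_mkcond; apply: eq_integral => x _.
rewrite /patch; case: ifPn => // _.
by rewrite /= normr0 powR0.
Qed.

Lemma hoelder_set X u g (p q : R) : measurable X ->
  measurable_fun X u -> measurable_fun X g ->
  (forall x, X x -> 0 <= u x) -> (forall x, X x -> 0 <= g x) ->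
  0 < p -> 0 < q -> p^-1 + q^-1 = 1 ->
  (\int[mu]_(x in X) (u x * g x)%:E <=
   (\int[mu]_(x in X) (u x `^ p)%:E) `^ p^-1 *
   (\int[mu]_(x in X) (g x `^ q)%:E) `^ q^-1)%E.
Proof.
move=> mX mU mG u0 g0 p0 q0 pq.
have := @hoelder _ _ _ mu (u \_ X) (g \_ X) p q.
move=> /(_ ((measurable_restrictT _ mX).1 mU) ((measurable_restrictT _ mX).1 mG) p0 q0 pq).
have E r w : 0 < r -> ('N[mu]_(r%:E)[EFin \o (w \_ X)] =
    (\int[mu]_(x in X) (`|w x| `^ r)%:E) `^ r^-1)%E.
  by move=> r0; rewrite -restrict_EFin Lnorm_patch// gt_eqF.
rewrite (E _ _ p0) (E _ _ q0) {E}.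
under [X in (_ <= X `^ _ * _)%E]eq_integral => x /[!inE] Xx do rewrite ger0_norm ?u0//.
under [X in (_ <= _ * X `^ _)%E]eq_integral => x /[!inE] Xx do rewrite ger0_norm ?g0//.
move=> /(le_trans _); apply; rewrite Lnorm1 integral_mkcond.
rewrite le_eqVlt; apply/orP; left; apply/eqP; apply: eq_integral => x _.
rewrite /patch /=; case: ifPn => xX.
  by rewrite ger0_norm// mulr_ge0 ?u0 ?g0//; exact: set_mem.
by rewrite mulr0 normr0.
Qed.

End LebesgueNorms.

(** The sum is at most twice the larger term. *)
Lemma powRD_le (R : realType) (a b q : R) : 0 <= a -> 0 <= b -> 0 <= q ->
  (a + b) `^ q <= 2 `^ q * (a `^ q + b `^ q).
Proof.
move=> a0 b0 q0.
wlog ab : a b a0 b0 / a <= b.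
  move=> H; case: (leP a b) => [|/ltW] ab; first exact: H.
  by rewrite addrC [a `^ q + _]addrC H.
apply: (@le_trans _ _ ((2 * b) `^ q)).
  by rewrite ge0_ler_powR ?nnegrE ?addr_ge0 ?mulr_ge0//; lra.
by rewrite powRM// ler_wpM2l ?powR_ge0// lerDr powR_ge0.
Qed.

Section LqFunctions.
Context {R : realType} {n : nat}.
Local Notation Rn := (n.-tuple R).
Local Notation mu := (@leb R n).
Local Notation normc := (@Normc.normc R).
Implicit Types (f g : Rn -> R[i]) (X : set Rn) (Q : cube R n).

Lemma LnormcE X q f : q != 0 -> Lnormc X q f =
  ((\int[mu]_(x in X) (normc (f x) `^ q)%:E) `^ q^-1)%E.
Proof.
move=> q0; rewrite /Lnormc.
have := @Lnorm_patch _ _ _ mu X (fun x => normc (f x)) q q0.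
under eq_integral do rewrite ger0_norm ?normc_ge0//.
done.
Qed.

Lemma measurable_normc_powR X f q : cmeasurable X f ->
  measurable_fun X (fun x => (normc (f x) `^ q)%:E).
Proof.
move=> mf; apply/measurable_EFinP.
apply: (@measurableT_comp _ _ _ _ _ _ (fun r : R => r `^ q) _ (fun x => normc (f x))) => //.
exact: measurable_normc.
Qed.

Lemma Lnormc_lty X q f : q != 0 -> (Lnormc X q f < +oo)%E <->
  (\int[mu]_(x in X) (normc (f x) `^ q)%:E < +oo)%E.
Proof.
move=> q0; rewrite LnormcE//; split => [|/poweR_lty//].
by apply: lty_poweRy; rewrite invr_eq0.
Qed.

(** Hölder against the constant 1, with conjugate exponent [(1 - q^-1)^-1]. *)
Lemma integral_normc_le X f q : measurable X -> (mu X < +oo)%E -> 1 < q ->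
  cmeasurable X f ->
  (\int[mu]_(x in X) (normc (f x))%:E <=
   (\int[mu]_(x in X) (normc (f x) `^ q)%:E) `^ q^-1 * (mu X) `^ (1 - q^-1))%E.
Proof.
move=> mX Xoo q1 mf.
have q0 : 0 < q by lra.
have iq : 0 < 1 - q^-1 by rewrite subr_gt0 invf_lt1.
have := @hoelder_set _ _ _ mu X (fun x => normc (f x)) (fun=> 1) q (1 - q^-1)^-1 mX.
rewrite invr_gt0 invrK => H.
have {H} := H (measurable_normc mf) (measurable_cst _).
have -> : (\int[mu]_(x in X) (1 `^ (1 - q^-1)^-1)%:E = mu X)%E.
  by under eq_integral do rewrite powR1; rewrite integral_cst// mul1e.
under eq_integral do rewrite mulr1.
apply => //.
- by move=> *; exact: normc_ge0.
- by rewrite addrCA subrr addr0.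
Qed.

End LqFunctions.

(** * Size of the moment projection *)

Section MomentProjection.
Context {R : realType} {n : nat}.
Local Notation Rn := (n.-tuple R).
Local Notation mu := (@leb R n).
Local Notation normc := (@Normc.normc R).
Local Notation cRe := (@complex.Re R).
Implicit Types (f g : Rn -> R[i]) (Q : cube R n) (P : mpoly.mpoly n R[i]).

Lemma integrable_normc X f : measurable X -> cintegrable X f ->
  mu.-integrable X (EFin \o (fun x => normc (f x))).
Proof.
move=> mX /cintegrableP-/(_ mX)[mf i]; apply/integrableP; split.
  exact: measurable_EFin_normc.
by under eq_integral do rewrite /= ger0_norm ?normc_ge0//.
Qed.

Lemma cintegrable_bounded_cube Q f (M : R) : cmeasurable (cube_set Q) f ->
  (forall x, cube_set Q x -> normc (f x) <= M) -> cintegrable (cube_set Q) f.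
Proof.
move=> mf fM; apply: (@cintegrable_le _ _ _ _ (fun=> M)) => //.
- exact: measurable_cube.
- rewrite integral_cst; last exact: measurable_cube.
  by rewrite (leb_cubeE Q) -EFinM ltry.
Qed.

Lemma cintegrableM_bounded_cube Q f g (M : R) : cintegrable (cube_set Q) f ->
  cmeasurable (cube_set Q) g -> (forall x, cube_set Q x -> normc (g x) <= M) ->
  cintegrable (cube_set Q) (fun x => f x * g x).
Proof.
have mQ := measurable_cube Q.
move=> fi mg gM; have [mf fi'] := (cintegrableP f mQ).1 fi.
apply: (@cintegrable_le _ _ _ _ (fun x => `|M| * normc (f x))) => //.
- exact: cmeasurableM.
- by apply: measurable_funM => //; exact: measurable_normc.
- move=> x Qx; rewrite Normc.normcM mulrC ler_wpM2r ?normc_ge0//.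
  by rewrite (le_trans (gM _ Qx))// ler_norm.
- under eq_integral do rewrite EFinM.
  rewrite ge0_integralZl//.
  + by rewrite lte_mul_pinfty.
  + exact: measurable_EFin_normc.
  + by move=> x _; rewrite lee_fin normc_ge0.
Qed.

Lemma cintegrable_polyfun Q P : cintegrable (cube_set Q) (polyfun P).
Proof.
have [M M0 PM] := polyfun_bounded P Q.
by apply: cintegrable_bounded_cube PM; exact: cmeasurable_polyfun.
Qed.

(* Interpolation on the segments issuing from x bounds |P(x)| by the values of
   |P| at images of y under homotheties of centre x, averaged over y in Q. *)
Lemma polyfun_sup_le (s : nat) : exists2 K : R, 0 < K &
  forall Q P, (mmeasure mdeg P <= s.+1)%N -> forall x, cube_set Q x ->
  normc (polyfun P x) * vol Q <= K * \int[mu]_(y in cube_set Q) normc (polyfun P y).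
Proof.
have [c cP] := @interpolation_at_0 R[i] s.
pose t (k : 'I_s.+1) : R := (k : nat).+1%:R / s.+1%:R.
have t0 k : 0 < t k by rewrite divr_gt0.
have t1 k : t k <= 1 by rewrite ler_pdivrMr// mul1r ler_nat.
(* The k-th node enters with its interpolation weight and with the factor [t k ^- n] of the change
   of variables; the 1 ensures [0 < K]. *)
pose K := 1 + \sum_k normc (c k) * t k ^- n.
have tn0 k : 0 <= normc (c k) * t k ^- n.
  by rewrite mulr_ge0 ?normc_ge0// invr_ge0 exprn_ge0// ltW.
exists K; first by rewrite ltr_pwDl// sumr_ge0.
move=> Q P degP x Qx.
have mQ := measurable_cube Q.
have iP := integrable_normc mQ (cintegrable_polyfun Q P).
have mP X : measurable_fun X (fun y => (normc (polyfun P y))%:E).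
  by apply: measurable_EFin_normc; exact: cmeasurable_polyfun.
have mH k : measurable_fun (cube_set Q)
    (fun y => (normc (polyfun P (homothety x (t k) y)))%:E).
  by apply: measurable_funTS; apply: (measurableT_comp (mP setT)); exact: measurable_affine.
rewrite -lee_fin !EFinM. rewrite [X in (_ <= _ * X)%E]fineK; last exact: (integrable_fin_num mQ iP).
have Hpt y : normc (polyfun P x) <=
    \sum_k normc (c k) * normc (polyfun P (homothety x (t k) y)).
  have [p sp pE] := polyfun_line degP x y.
  (* Ratio 0 collapses the segment to [x], so interpolation at 0 recovers the value at [x]. *)
  have := pE 0; rewrite (_ : homothety x 0 y = x); last first.
    by apply: eq_from_tnth => i; rewrite homothetyE subr0 mul1r mul0r addr0.
  rewrite (cP _ sp) => <-; apply: (le_trans (normc_sum _ _ _)).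
  apply: ler_sum => k _; rewrite Normc.normcM -pE.
  by rewrite (_ : (t k)%:C%C = (k : nat).+1%:R / s.+1%:R)// rmorphM fmorphV !rmorph_nat.
apply: (@le_trans _ _ (\int[mu]_(y in cube_set Q) (\sum_(k < s.+1)
    (normc (c k))%:E * (normc (polyfun P (homothety x (t k) y)))%:E))%E).
  have <- : (\int[mu]_(y in cube_set Q) (normc (polyfun P x))%:E =
      (normc (polyfun P x))%:E * (vol Q)%:E)%E by rewrite integral_cst// leb_cubeE.
  apply: ge0_le_integral.
  - exact: mQ.
  - by move=> y _; rewrite lee_fin normc_ge0.
  - exact: measurable_cst.
  - by apply: emeasurable_sum => k; apply: measurable_funeM; exact: mH.
  - move=> y _; under eq_bigr do rewrite -EFinM.
    by rewrite sumEFin lee_fin.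
rewrite ge0_integral_sum; last 3 first.
- exact: mQ.
- by move=> k; apply: measurable_funeM; exact: mH.
- by move=> k y _; rewrite -EFinM lee_fin mulr_ge0// normc_ge0.
apply: (@le_trans _ _ (\sum_(k < s.+1) (normc (c k) * t k ^- n)%:E *
    \int[mu]_(y in cube_set Q) (normc (polyfun P y))%:E)%E).
  apply: lee_sum => k _.
  have H0 y : cube_set Q y ->
      (0 <= (normc (polyfun P (homothety x (t k) y)))%:E)%E.
    by rewrite lee_fin normc_ge0.
  have c0 : (0 <= (normc (c k))%:E)%E by rewrite lee_fin normc_ge0.
  rewrite (ge0_integralZl _ mQ (mH k) H0 c0) EFinM -muleA; apply: lee_wpmul2l => //.
  apply: (@integral_homothety_le _ _ Q x (t k) (fun y => (normc (polyfun P y))%:E)).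
  - exact: t0.
  - exact: t1.
  - exact: Qx.
  - exact: mP.
  - by move=> y; rewrite lee_fin normc_ge0.
rewrite -ge0_sume_distrl; last by move=> k _; rewrite lee_fin.
rewrite sumEFin lee_wpmul2r//.
  by apply: integral_ge0 => y _; rewrite lee_fin normc_ge0.
by rewrite lee_fin /K lerDr.
Qed.

(** Monomials are real, so the conjugate of [P] is again a combination of monomials of degree at
    most [s], against which all moments vanish. *)
Lemma moment_proj_orthogonal s Q f P : cintegrable (cube_set Q) f ->
  is_moment_proj s Q f P ->
  cintegrable (cube_set Q) (fun x => (f x - polyfun P x) * (polyfun P x)^*%C) /\
  cintegral (cube_set Q) (fun x => (f x - polyfun P x) * (polyfun P x)^*%C) = 0.
Proof.
move=> fi [degP momP]; have mQ := measurable_cube Q.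
have gi : cintegrable (cube_set Q) (fun x => f x - polyfun P x).
  rewrite (_ : (fun _ => _) = (fun x => f x + (-1) * polyfun P x)).
    apply: cintegrableD => //; apply: cintegrableZ => //; exact: cintegrable_polyfun.
  by apply/funext => x; rewrite mulN1r.
rewrite (_ : (fun _ => _) = (fun x => \sum_(m <- msupp P)
    (mcoeff m P)^*%C * ((f x - polyfun P x) * monomial m x))); last first.
  apply/funext => x; rewrite [X in _ * X^*%C]polyfunE rmorph_sum mulr_sumr.
  apply: eq_bigr => m _; by rewrite rmorphM /= monomial_real; ring.
have mi m : cintegrable (cube_set Q) (fun x => (f x - polyfun P x) * monomial m x).
  have [M M0 PM] := polyfun_bounded (mpolyX R[i] m) Q.
  apply: (@cintegrableM_bounded_cube _ _ _ M) => //; first exact: cmeasurable_monomial.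
  by move=> x /PM; rewrite /polyfun mevalX.
have [? ->] := @cintegral_sum R n (cube_set Q) _ (msupp P)
    (fun m x => (mcoeff m P)^*%C * ((f x - polyfun P x) * monomial m x)) mQ
    (fun m _ => cintegrableZ _ mQ (mi m)).
split => //; rewrite big_seq big1// => m mP.
rewrite cintegralZ// momP ?mulr0//.
by rewrite -ltnS (leq_trans _ degP)// mmeasure_mnm_lt.
Qed.

(** One factor [K] passes from the supremum of |P| to its mean, the other from the mean of |P| to
    that of |f|. *)
Lemma moment_proj_sup_le (s : nat) : exists2 K : R, 0 < K &
  forall Q f P, cintegrable (cube_set Q) f -> is_moment_proj s Q f P ->
  forall x, cube_set Q x ->
  normc (polyfun P x) * vol Q <= K * \int[mu]_(y in cube_set Q) normc (f y).
Proof.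
have [K K0 supP] := polyfun_sup_le s.
exists (K * K); first exact: mulr_gt0.
move=> Q f P fi PQ x Qx; have mQ := measurable_cube Q.
have V0 := vol_gt0 Q.
have [degP momP] := PQ.
set I := \int[mu]_(y in cube_set Q) normc (f y).
pose m := \int[mu]_(y in cube_set Q) normc (polyfun P y).
pose J := \int[mu]_(y in cube_set Q) (normc (polyfun P y) ^+ 2).
have iP := integrable_normc mQ (cintegrable_polyfun Q P).
have ifn := integrable_normc mQ fi.
have [M M0 PM] := polyfun_bounded P Q.
have iP2 : mu.-integrable (cube_set Q) (EFin \o (fun y => normc (polyfun P y) ^+ 2)).
  have := integrable_normc mQ (cintegrableM_bounded_cube (cintegrable_polyfun Q P)
    (cmeasurable_polyfun _ P) PM).
  by apply: eq_integrable => // y _; rewrite /= Normc.normcM.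
have icst (a : R) : mu.-integrable (cube_set Q) (EFin \o (fun=> a)).
  apply/integrableP; split; first exact: measurable_cst.
  by rewrite /= integral_cst// leb_cubeE -EFinM ltry.
have iZ (a : R) (u : Rn -> R) : mu.-integrable (cube_set Q) (EFin \o u) ->
    mu.-integrable (cube_set Q) (EFin \o (fun x => a * u x)).
  move=> iu; have := integrableZl mQ a iu; apply: eq_integrable => //.
have iD (u w : Rn -> R) : mu.-integrable (cube_set Q) (EFin \o u) ->
    mu.-integrable (cube_set Q) (EFin \o w) ->
    mu.-integrable (cube_set Q) (EFin \o (fun x => u x + w x)).
  move=> iu iw; have := integrableD mQ iu iw; apply: eq_integrable => //.
have m0 : 0 <= m by apply: Rintegral_ge0 => y _; exact: normc_ge0.
have I0 : 0 <= I by apply: Rintegral_ge0 => y _; exact: normc_ge0.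
have H1 y : cube_set Q y -> normc (polyfun P y) * vol Q <= K * m by exact: supP.
(* Cauchy-Schwarz, by integrating [(|P| - m / |Q|)^2 >= 0]. *)
have H2 : m ^+ 2 <= vol Q * J.
  have : \int[mu]_(y in cube_set Q) (2 * (m / vol Q) * normc (polyfun P y)) <=
      \int[mu]_(y in cube_set Q) (normc (polyfun P y) ^+ 2 + (m / vol Q) ^+ 2).
    apply: le_Rintegral => //; [exact: iZ|exact: iD|] => y _.
    by have := sqr_ge0 (normc (polyfun P y) - m / vol Q); nra.
  rewrite RintegralZl// RintegralD// Rintegral_cst// (leb_cubeE Q) /= -/m -/J.
  have -> : 2 * (m / vol Q) * m = 2 * (m ^+ 2 / vol Q) by ring.
  have -> : (m / vol Q) ^+ 2 * vol Q = m ^+ 2 / vol Q by field; exact: lt0r_neq0.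
  by rewrite -ler_pdivrMl// mulrC; lra.
(* By orthogonality [J] is the real part of the integral of [f] times the conjugate of [P], and |P|
   is at most [K * m / vol Q]. *)
have H3 : J <= K * m / vol Q * I.
  have [gi g0] := moment_proj_orthogonal fi PQ.
  have : 0 <= \int[mu]_(y in cube_set Q)
      (K * m / vol Q * normc (f y) + (-1) * normc (polyfun P y) ^+ 2).
    have -> : 0 = \int[mu]_(y in cube_set Q)
        cRe ((f y - polyfun P y) * (polyfun P y)^*%C) by case: g0.
    apply: le_Rintegral => //; [by case: gi|by apply: iD; exact: iZ|] => y Qy.
    rewrite mulrBl ReD ReN ReM_conj mulN1r lerD2r.
    apply: (le_trans (ler_norm _)); apply: (le_trans (Re_le_normc _)).
    rewrite Normc.normcM normc_conj mulrC ler_wpM2r ?normc_ge0//.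
    by rewrite ler_pdivlMr// H1.
  rewrite RintegralD//; [|exact: iZ|exact: iZ].
  rewrite !RintegralZl// -/I -/J; lra.
(* [H2] and [H3] give [m ^+ 2 <= K * m * I], from which [m] can be cancelled unless it is 0. *)
have H4 : m <= K * I.
  have [->|mn0] := eqVneq m 0; first by rewrite mulr_ge0// ltW.
  have mp : 0 < m by rewrite lt_neqAle eq_sym mn0.
  rewrite -(ler_pM2r mp) -expr2 (le_trans H2)//.
  have : vol Q * J <= vol Q * (K * m / vol Q * I) by rewrite ler_wpM2l// ltW.
  by move=> /le_trans; apply; rewrite le_eqVlt; apply/orP; left; apply/eqP;
    field; exact: lt0r_neq0.
apply: (le_trans (H1 _ Qx)); rewrite -mulrA; apply: ler_wpM2l => //; exact: ltW.
Qed.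

End MomentProjection.

(** * The inclusion of L^q in jn *)

Section CubeFamilies.
Context {R : realType} {n : nat}.
Local Notation Rn := (n.-tuple R).
Local Notation mu := (@leb R n).
Implicit Types (X : set Rn) (D : set nat) (Q : nat -> cube R n).

(** Filled up with empty sets to a disjoint sequence over all of [nat], the form that countable
    additivity expects. *)
Definition interior_family D Q (j : nat) : set Rn :=
  if j \in D then cube_interior (Q j) else set0.

Lemma measurable_interior_family D Q j : measurable (interior_family D Q j).
Proof. by rewrite /interior_family; case: ifP => // _; exact: measurable_cube_interior. Qed.

Lemma trivIset_interior_family X D Q : cube_family X D Q ->
  trivIset setT (interior_family D Q).
Proof.
move=> [_ tD] i j _ _; rewrite /interior_family.
case: ifPn => [/set_mem Di|_]; last by case=> x [].
case: ifPn => [/set_mem Dj|_]; last by case=> x [].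
exact: tD.
Qed.

Lemma integral_cube_interior (Q : cube R n) (u : Rn -> \bar R) :
  measurable_fun (cube_set Q) u -> (forall x, cube_set Q x -> 0 <= u x)%E ->
  (\int[mu]_(x in cube_set Q) u x = \int[mu]_(x in cube_interior Q) u x)%E.
Proof.
move=> mu' u0; have mQ := measurable_cube Q; have mI := measurable_cube_interior Q.
rewrite (@ge0_negligible_integral _ _ _ mu _ (cube_set Q `\` cube_interior Q))//.
- rewrite setDD; have /setIidPr -> // := @cube_interior_sub R n Q.
- exact: measurableD.
- exact: leb_cube_boundary.
Qed.

(** Null boundaries turn each integral into one over an interior, and the interiors are disjoint. *)
Lemma family_integralE X D Q (u : Rn -> \bar R) : measurable X -> measurable_fun X u ->
  (forall x, X x -> 0 <= u x)%E -> cube_family X D Q ->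
  (\sum_(0 <= j <oo | j \in D) \int[mu]_(x in cube_set (Q j)) u x =
   \int[mu]_(x in \bigcup_j interior_family D Q j) u x)%E.
Proof.
move=> mX mu' u0 fQ; have [QX _] := fQ.
have IX : \bigcup_j interior_family D Q j `<=` X.
  move=> x [j _]; rewrite /interior_family; case: ifPn => // /set_mem Dj Ix.
  by apply: (QX _ Dj); exact: cube_interior_sub.
rewrite ge0_integral_bigcup//.
- rewrite eseries_mkcond; apply: eq_eseriesr => j _.
  rewrite /interior_family; case: ifPn => [/set_mem Dj|_].
    rewrite integral_cube_interior//; first exact: (measurable_funS mX (QX _ Dj)).
    by move=> x /(QX _ Dj); exact: u0.
  by rewrite integral_set0.
- exact: measurable_interior_family.
- exact: (measurable_funS mX IX).
- by move=> x /IX; exact: u0.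
- exact: trivIset_interior_family fQ.
Qed.

Lemma family_integral_le X D Q (u : Rn -> \bar R) : measurable X -> measurable_fun X u ->
  (forall x, X x -> 0 <= u x)%E -> cube_family X D Q ->
  (\sum_(0 <= j <oo | j \in D) \int[mu]_(x in cube_set (Q j)) u x <=
   \int[mu]_(x in X) u x)%E.
Proof.
move=> mX mu' u0 fQ; rewrite (family_integralE mX)//.
apply: ge0_subset_integral => //.
  by apply: bigcup_measurable => j _; exact: measurable_interior_family.
move=> x [j _]; rewrite /interior_family; case: ifPn => // /set_mem Dj Ix.
by apply: (fQ.1 _ Dj); exact: cube_interior_sub.
Qed.

Lemma family_vol_le X D Q : measurable X -> cube_family X D Q ->
  (\sum_(0 <= j <oo | j \in D) (vol (Q j))%:E <= mu X)%E.
Proof.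
move=> mX fQ.
have := @family_integral_le X D Q (cst 1%E) mX (@measurable_cst _ _ _ _ _ _) (fun _ _ => lee01) fQ.
rewrite integral_cst// mul1e; apply: le_trans.
rewrite le_eqVlt; apply/orP; left; apply/eqP; apply: eq_eseriesr => j _.
by rewrite integral_cst ?mul1e ?leb_cubeE//; exact: measurable_cube.
Qed.

End CubeFamilies.

Section LqInJN.
Context {R : realType} {n : nat}.
Local Notation Rn := (n.-tuple R).
Local Notation mu := (@leb R n).
Local Notation normc := (@Normc.normc R).
Implicit Types (f g : Rn -> R[i]) (Q : cube R n) (X : set Rn).

Lemma integral_normc_ge0 X f q : (0 <= \int[mu]_(x in X) (normc (f x) `^ q)%:E)%E.
Proof. by apply: integral_ge0 => x _; rewrite lee_fin powR_ge0. Qed.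

Lemma cintegrable_Lq_cube Q f q : 1 < q -> cmeasurable (cube_set Q) f ->
  (\int[mu]_(x in cube_set Q) (normc (f x) `^ q)%:E < +oo)%E ->
  cintegrable (cube_set Q) f.
Proof.
move=> q1 mf fq; have mQ := measurable_cube Q.
have Qoo : (mu (cube_set Q) < +oo)%E by rewrite leb_cube ltry.
apply/cintegrableP => //; split => //.
apply: (le_lt_trans (integral_normc_le mQ Qoo q1 mf)).
rewrite lte_mul_pinfty ?poweR_ge0 ?poweR_lty//.
by rewrite fin_num_poweR// ge0_fin_numE// integral_normc_ge0.
Qed.

(** On [Q] the projection is at most a constant times the mean of |f|, whose q-th power is at most
    the mean of |f|^q. The constant does not depend on [Q], so the estimate can be summed over a
    family. *)
Lemma osc_le (s : nat) (c0 q : R) : 1 < q -> exists2 K : R, 1 <= K &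
  forall Q f, cmeasurable (cube_set Q) f ->
  (\int[mu]_(x in cube_set Q) (normc (f x) `^ q)%:E < +oo)%E ->
  (\int[mu]_(x in cube_set Q)
     (normc (f x - polyfun (local_moment_proj s c0 Q f) x) `^ q)%:E <=
   K%:E * \int[mu]_(x in cube_set Q) (normc (f x) `^ q)%:E)%E.
Proof.
move=> q1; have q0 : 0 < q by lra.
have [K1 K10 HK1] := @moment_proj_sup_le R n s.
have two_q : 1 <= 2 `^ q by have := @ler_powR R 2 (ler1n _ 2) 0 q (ltW q0); rewrite powRr0.
exists (2 `^ q * (1 + K1 `^ q)).
  by rewrite -[leLHS]mulr1 ler_pM// lerDl powR_ge0.
move=> Q f mf fq.
set A := (\int[mu]_(x in cube_set Q) (normc (f x) `^ q)%:E)%E.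
have A0 : (0 <= A)%E by exact: integral_normc_ge0.
have trivial_case : (\int[mu]_(x in cube_set Q)
     (normc (f x - polyfun 0 x) `^ q)%:E <= (2 `^ q * (1 + K1 `^ q))%:E * A)%E.
  under eq_integral do rewrite polyfun0 subr0.
  rewrite -/A -[leLHS]mul1e lee_wpmul2r// lee_fin.
  by rewrite -[leLHS]mulr1 ler_pM// lerDl powR_ge0.
rewrite /local_moment_proj; case: ifP => _; last exact: trivial_case.
(* Should no projection exist, the default value is 0 and nothing is subtracted, as on large
   cubes. *)
rewrite /moment_proj; case: xgetP => [P _ PQ|_]; last exact: trivial_case.
have mQ := measurable_cube Q; have V0 := vol_gt0 Q.
have fi := cintegrable_Lq_cube q1 mf fq.
pose I := \int[mu]_(y in cube_set Q) normc (f y).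
have I0 : 0 <= I by apply: Rintegral_ge0 => y _; exact: normc_ge0.
have Afin : A \is a fin_num by rewrite ge0_fin_numE.
pose a := fine A.
have a0 : 0 <= a by exact: fine_ge0.
have aE : A = a%:E by rewrite fineK.
(* Jensen's inequality without its normalization, from Hölder raised to the power [q]. *)
have Iq : I `^ q <= a * vol Q `^ (q - 1).
  have : I <= a `^ q^-1 * vol Q `^ (1 - q^-1).
    have Qoo : (mu (cube_set Q) < +oo)%E by rewrite leb_cube ltry.
    have := integral_normc_le mQ Qoo q1 mf.
    rewrite -/A aE leb_cubeE !poweR_EFin -EFinM -lee_fin; apply: le_trans.
    by rewrite /I [X in (X <= _)%E]fineK//; exact: (integrable_fin_num mQ (integrable_normc mQ fi)).
  move=> /(fun h => ge0_ler_powR (ltW q0) I0 (mulr_ge0 (powR_ge0 _ _) (powR_ge0 _ _)) h).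
  rewrite powRM ?powR_ge0// -!powRrM mulVf ?gt_eqF// powRr1//.
  by rewrite mulrBl mul1r mulVf ?gt_eqF.
have HP x : cube_set Q x -> normc (polyfun P x) `^ q <= (K1 * I / vol Q) `^ q.
  move=> Qx; rewrite ge0_ler_powR ?nnegrE ?normc_ge0 ?(ltW q0)//.
    by rewrite divr_ge0 ?mulr_ge0// ltW.
  by rewrite ler_pdivlMr//; exact: HK1.
apply: (@le_trans _ _ (\int[mu]_(x in cube_set Q)
   ((2 `^ q)%:E * ((normc (f x) `^ q)%:E + ((K1 * I / vol Q) `^ q)%:E)))%E).
  apply: ge0_le_integral => //.
  - by move=> x _; rewrite lee_fin powR_ge0.
  - apply: measurable_normc_powR; apply: cmeasurableB => //; exact: cmeasurable_polyfun.
  - apply: measurable_funeM; apply: emeasurable_funD => //; exact: measurable_normc_powR.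
  - move=> x Qx; rewrite -EFinD -EFinM lee_fin.
    apply: (@le_trans _ _ ((normc (f x) + normc (polyfun P x)) `^ q)).
      rewrite ge0_ler_powR ?nnegrE ?normc_ge0 ?addr_ge0 ?normc_ge0 ?(ltW q0)//.
      by rewrite -(normcN (polyfun P x)) le_normcD.
    apply: (le_trans (powRD_le (normc_ge0 _) (normc_ge0 _) (ltW q0))).
    by rewrite ler_wpM2l ?powR_ge0// lerD2l HP.
have mfq : measurable_fun (cube_set Q) (fun x => (normc (f x) `^ q)%:E).
  exact: measurable_normc_powR.
have mS : measurable_fun (cube_set Q)
    (fun x => (normc (f x) `^ q)%:E + ((K1 * I / vol Q) `^ q)%:E)%E.
  by apply: emeasurable_funD => //; exact: measurable_cst.
have S0 x : cube_set Q x -> (0 <= (normc (f x) `^ q)%:E + ((K1 * I / vol Q) `^ q)%:E)%E.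
  by move=> _; rewrite -EFinD lee_fin addr_ge0// powR_ge0.
have C0 : (0 <= (2 `^ q)%:E)%E by rewrite lee_fin powR_ge0.
rewrite (ge0_integralZl _ mQ mS S0 C0) ge0_integralD; last 5 first.
- exact: mQ.
- by move=> x _; rewrite lee_fin powR_ge0.
- exact: mfq.
- by move=> x _; rewrite lee_fin powR_ge0.
- exact: measurable_cst.
rewrite integral_cst// leb_cubeE -/A aE.
change ((2 `^ q * (a + (K1 * I / vol Q) `^ q * vol Q))%:E <=
  (2 `^ q * (1 + K1 `^ q) * a)%:E)%E.
rewrite lee_fin -[leRHS]mulrA.
rewrite ler_wpM2l ?powR_ge0// mulrDl mul1r lerD2l.
rewrite !powRM ?mulr_ge0 ?invr_ge0 ?(ltW V0) ?(ltW K10)//.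
rewrite -!mulrA ler_wpM2l ?powR_ge0//.
(* This is exactly the inverse of the volume factor in [Iq]. *)
have -> : (vol Q)^-1 `^ q * vol Q = (vol Q `^ (q - 1))^-1.
  rewrite -(powR_inv1 (ltW V0)) -powRrM mulN1r powRN -(mulr_powRB1 (ltW V0) q0).
  by rewrite invfM mulrAC mulVf ?mul1r ?gt_eqF.
by rewrite ler_pdivrMr// powR_gt0.
Qed.

Lemma Lqspace_sub X Y f q : measurable X -> measurable Y -> q != 0 -> X `<=` Y -> Lqspace Y q f ->
  Lqspace X q f.
Proof.
move=> mX mY q0 XY [mf /Lnormc_lty-/(_ q0) fq]; split.
  exact: (cmeasurableS mY XY).
apply/Lnormc_lty => //; apply: le_lt_trans fq; apply: ge0_subset_integral => //.
- exact: measurable_normc_powR.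
- by move=> x _; rewrite lee_fin powR_ge0.
Qed.

(** According to whether [x] is at least 1 or at most 1. When the inequality is weighted by volumes
    and summed over a family, the 1 costs at most the measure of [X]. *)
Lemma poweR_le1D (x : \bar R) (p q : R) : (0 <= x)%E -> 0 < p -> p <= q ->
  (x `^ p <= 1 + x `^ q)%E.
Proof.
move=> x0 p0 pq; case: x x0 => [x| |//]; last first.
  by rewrite !poweRyr ?addey// gt_eqF//; exact: lt_le_trans pq.
rewrite lee_fin => x0; rewrite !poweR_EFin -EFinD lee_fin.
have [x1|/ltW x1] := leP 1 x.
  by apply: (le_trans (ler_powR x1 pq)); rewrite lerDr.
apply: (@le_trans _ _ 1); last by rewrite lerDl powR_ge0.
have := @ge0_ler_powR R p (ltW p0) x 1; rewrite !nnegrE powR1; exact.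
Qed.

Lemma vol_mean_osc Q f s c0 q : 0 < q ->
  ((vol Q)%:E * mean_osc q s c0 f Q `^ q = \int[mu]_(x in cube_set Q)
     (normc (f x - polyfun (local_moment_proj s c0 Q f) x) `^ q)%:E)%E.
Proof.
move=> q0; have V0 := vol_gt0 Q; rewrite /mean_osc -poweRrM mulVf ?gt_eqF// poweRe1.
  by rewrite muleA -EFinM mulfV ?gt_eqF// mul1e.
by rewrite mule_ge0 ?integral_normc_ge0// lee_fin invr_ge0 ltW.
Qed.

(** For p < q the p-th power of each oscillation is at most 1 plus its q-th power, so finite measure
    is needed; for p = q [osc_le] can be summed directly. *)
Lemma Lqspace_jn X p q s c0 f : measurable X -> 1 < p -> p <= q ->
  (p < q -> (mu X < +oo)%E) -> Lqspace X q f -> jn p q s c0 X f.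
Proof.
move=> mX p1 pq muX fX.
have q1 : 1 < q by exact: lt_le_trans pq.
have q0 : 0 < q by lra. have p0 : 0 < p by lra.
have qn0 : q != 0 by rewrite gt_eqF.
have [mf /Lnormc_lty-/(_ qn0) fq] := fX.
split.
  split => // E mE EX _.
  by have [] := Lqspace_sub mE mX qn0 EX fX.
have [K K1 HK] := @osc_le s c0 q q1.
(* [V] is 0 when p = q, which keeps the bound finite on a space of infinite measure. *)
pose V : \bar R := if p < q then mu X else 0%E.
have V0 : (0 <= V)%E by rewrite /V; case: ifP.
have Voo : (V < +oo)%E by rewrite /V; case: ifPn => [/muX|].
apply: (@le_lt_trans _ _ ((V + K%:E * \int[mu]_(x in X) (normc (f x) `^ q)%:E) `^ p^-1)%E).
  apply: ge_ereal_sup => _ [D [Q [fQ ->]]].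
  have S0 j : (0 <= (vol (Q j))%:E * mean_osc q s c0 f (Q j) `^ p)%E.
    by rewrite mule_ge0 ?poweR_ge0// lee_fin ltW// vol_gt0.
  have K0 : (0 <= K%:E)%E by rewrite lee_fin; lra.
  rewrite gt0_ler_poweR ?invr_ge0 ?(ltW p0)//.
  - by rewrite in_itv /= leey andbT nneseries_ge0.
  - by rewrite in_itv /= leey andbT adde_ge0// mule_ge0// integral_normc_ge0.
  apply: (@le_trans _ _ (\sum_(0 <= j <oo | j \in D)
     ((if (p < q)%R then (vol (Q j))%:E else 0) +
       K%:E * \int[mu]_(x in cube_set (Q j)) (normc (f x) `^ q)%:E))%E).
    apply: lee_nneseries => [j _ _|j /set_mem Dj]; first exact: S0.
    have mj := measurable_cube (Q j).
    have [mfj /Lnormc_lty-/(_ qn0) fj] := Lqspace_sub mj mX qn0 (fQ.1 _ Dj) fX.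
    have := HK (Q j) f mfj fj; rewrite -(vol_mean_osc _ _ _ _ q0) => Hj.
    case: ifPn => [_|].
      apply: (@le_trans _ _ ((vol (Q j))%:E * (1 + mean_osc q s c0 f (Q j) `^ q))%E).
        rewrite lee_wpmul2l// ?lee_fin ?(ltW (vol_gt0 _))//.
        by apply: poweR_le1D => //; exact: poweR_ge0.
      by rewrite ge0_muleDr ?poweR_ge0// mule1 leeD2l.
    rewrite -leNgt => qp; have <- : p = q by apply/le_anti; rewrite pq qp.
    rewrite add0e; move: Hj; have -> // : q = p by apply/le_anti; rewrite pq qp.
  rewrite nneseriesD; last 2 first.
  - by move=> j _ _; case: ifP => // _; rewrite lee_fin ltW// vol_gt0.
  - by move=> j _ _; rewrite mule_ge0// integral_normc_ge0.
  rewrite leeD//.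
    rewrite /V; case: ifPn => _; last by rewrite eseries0.
    exact: family_vol_le.
  rewrite nneseriesZl//; last by move=> j _; exact: integral_normc_ge0.
  rewrite lee_wpmul2l// family_integral_le//; first exact: measurable_normc_powR.
  by move=> x _; rewrite lee_fin powR_ge0.
rewrite poweR_lty// lte_add_pinfty// lte_mul_pinfty// lee_fin; lra.
Qed.

End LqInJN.

(** * Absolutely summable series in L^w *)

Section LebesguePairing.
Context {R : realType} {n : nat}.
Local Notation Rn := (n.-tuple R).
Local Notation mu := (@leb R n).
Local Notation normc := (@Normc.normc R).
Local Notation cRe := (@complex.Re R).
Local Notation cIm := (@complex.Im R).
Implicit Types (f g h : Rn -> R[i]) (X : set Rn).

Lemma complex_cvg (z : nat -> R[i]) (l : R[i]) :
  (fun N => cRe (z N)) @ \oo --> cRe l -> (fun N => cIm (z N)) @ \oo --> cIm l ->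
  z @ \oo --> (l : R[i]^o).
Proof.
move=> /cvgrPdist_lt hr /cvgrPdist_lt hi.
apply/(@cvgrPdist_lt _ R[i]^o) => e e0.
(* In the partial order of [R[i]], positivity forces [e] to be real. *)
have [er ei] : 0 < cRe e /\ cIm e = 0 by move: e0; rewrite ltcE /= => /andP[/eqP -> ->].
have eE : e = (cRe e)%:C%C by case: e er ei {e0} => a b /= _ ->.
have e2 : 0 < cRe e / 2 by rewrite divr_gt0.
near=> N.
rewrite eE /Num.norm /= ltcR.
apply: (le_lt_trans (normc_le_ReIm _)).
rewrite ReD ImD ReN ImN (splitr (cRe e)) ltrD//.
- by near: N; exact: hr.
- by near: N; exact: hi.
Unshelve. all: by end_near. Qed.

Lemma complex_cvg_unique (z : nat -> R[i]) (l m : R[i]) :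
  z @ \oo --> (l : R[i]^o) -> z @ \oo --> (m : R[i]^o) -> l = m.
Proof. by move=> zl zm; exact: (cvg_unique (@norm_hausdorff _ R[i]^o) zl zm). Qed.

Lemma cvg_normc (z : nat -> R[i]) (l : R[i]) :
  (fun N => cRe (z N)) @ \oo --> cRe l -> (fun N => cIm (z N)) @ \oo --> cIm l ->
  (fun N => normc (z N)) @ \oo --> normc l.
Proof.
move=> hr hi; rewrite normcE.
rewrite (_ : (fun N => _) = (@Num.sqrt R) \o (fun N => cRe (z N) ^+ 2 + cIm (z N) ^+ 2)).
  apply: continuous_cvg; first exact: sqrt_continuous.
  by apply: cvgD; rewrite !expr2; under eq_fun do rewrite expr2; exact: cvgM.
by apply/funext => N /=; rewrite normcE.
Qed.

Lemma integral_mul_lty X (u g : Rn -> R) (p q : R) : measurable X ->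
  measurable_fun X u -> measurable_fun X g ->
  (forall x, X x -> 0 <= u x) -> (forall x, X x -> 0 <= g x) ->
  0 < p -> 0 < q -> p^-1 + q^-1 = 1 ->
  (\int[mu]_(x in X) (u x `^ p)%:E < +oo)%E ->
  (\int[mu]_(x in X) (g x `^ q)%:E < +oo)%E ->
  (\int[mu]_(x in X) (u x * g x)%:E < +oo)%E.
Proof.
move=> mX mU mG u0 g0 p0 q0 pq up gq.
apply: (le_lt_trans (hoelder_set mu mX mU mG u0 g0 p0 q0 pq)).
have U0 : (0 <= \int[mu]_(x in X) (u x `^ p)%:E)%E.
  by apply: integral_ge0 => x _; rewrite lee_fin powR_ge0.
apply: lte_mul_pinfty; [exact: poweR_ge0| |exact: poweR_lty].
by apply: fin_num_poweR; rewrite (ge0_fin_numE U0); exact: up.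
Qed.

Lemma cintegrable_mul X h f (w q : R) : measurable X -> 0 < w -> 0 < q ->
  w^-1 + q^-1 = 1 -> Lqspace X w h -> Lqspace X q f ->
  cintegrable X (fun x => h x * f x).
Proof.
move=> mX w0 q0 wq [mh hw] [mf fq].
move/Lnormc_lty : hw; rewrite gt_eqF// => /(_ isT) hw.
move/Lnormc_lty : fq; rewrite gt_eqF// => /(_ isT) fq.
apply/cintegrableP => //; split; first exact: cmeasurableM.
have := integral_mul_lty mX (measurable_normc mh) (measurable_normc mf)
  (fun x _ => normc_ge0 _) (fun x _ => normc_ge0 _) w0 q0 wq hw fq.
by under eq_integral do rewrite -Normc.normcM.
Qed.

(** The 2 comes from bounding real and imaginary parts separately. The estimate serves to bound
    functionals and to see that a pairing vanishes, so the 2 does not enter the comparison of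
    norms. *)
Lemma cintegral_mul_le X h f (w q : R) : measurable X -> 0 < w -> 0 < q ->
  w^-1 + q^-1 = 1 -> Lqspace X w h -> Lqspace X q f ->
  ((normc (cintegral X (fun x => h x * f x)%R))%:E <=
   2%:E * (Lnormc X w h * Lnormc X q f))%E.
Proof.
move=> mX w0 q0 wq Lh fq.
have ihf := cintegrable_mul mX w0 q0 wq Lh fq.
have Ni := integrable_normc mX ihf.
pose I := \int[mu]_(x in X) normc (h x * f x).
have Ile : (I%:E <= Lnormc X w h * Lnormc X q f)%E.
  rewrite /I fineK; last exact: (integrable_fin_num mX Ni).
  rewrite !LnormcE ?gt_eqF//.
  apply: le_trans (hoelder_set mu mX (measurable_normc Lh.1) (measurable_normc fq.1)
    (fun x _ => normc_ge0 _) (fun x _ => normc_ge0 _) w0 q0 wq).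
  rewrite (_ : (\int[mu]_(x in X) _ = \int[mu]_(x in X) (normc (h x) * normc (f x))%:E)%E).
    exact: lexx.
  by apply: eq_integral => x _; rewrite /= Normc.normcM.
apply: (@le_trans _ _ (2%:E * I%:E)%E); last by rewrite lee_wpmul2l// lee_fin.
rewrite -EFinM lee_fin; apply: (le_trans (normc_le_ReIm _)); rewrite mulr_natl mulr2n.
case: ihf => ir ii; apply: lerD; rewrite /cintegral /=.
- apply: (le_trans (le_normr_Rintegral mX ir)).
  apply: le_Rintegral => //; first exact: (integrable_norm ir).
  by move=> x _; exact: Re_le_normc.
- apply: (le_trans (le_normr_Rintegral mX ii)).
  apply: le_Rintegral => //; first exact: (integrable_norm ii).
  by move=> x _; exact: Im_le_normc.
Qed.

Definition abs_sum (u : nat -> Rn -> R[i]) (x : Rn) : \bar R :=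
  (\sum_(j <oo) (normc (u j x))%:E)%E.

Lemma abs_sum_ge0 u x : (0 <= abs_sum u x)%E.
Proof. by apply: nneseries_ge0 => j _ _; rewrite lee_fin normc_ge0. Qed.

Lemma measurable_abs_sum X u : (forall j, cmeasurable X (u j)) ->
  measurable_fun X (abs_sum u).
Proof.
move=> mu'; apply: (@ge0_emeasurable_sum _ _ _ X (fun j x => (normc (u j x))%:E) predT).
- by move=> k x _ _; rewrite lee_fin normc_ge0.
- by move=> k _; exact: measurable_EFin_normc.
Qed.

Lemma measurable_abs_sum_poweR X u w : (forall j, cmeasurable X (u j)) ->
  measurable_fun X (fun x => abs_sum u x `^ w)%E.
Proof.
move=> mu'.
apply: (@measurableT_comp _ _ _ _ _ _ (fun y : \bar R => y `^ w)%E _ (abs_sum u)).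
  exact: measurable_poweR.
exact: measurable_abs_sum.
Qed.

Lemma le_abs_sum u N x :
  ((\sum_(0 <= j < N) normc (u j x))%:E <= abs_sum u x)%E.
Proof.
rewrite -sumEFin; apply: (@nneseries_lim_ge _ (fun j => (normc (u j x))%:E)).
by move=> j _ _; rewrite lee_fin normc_ge0.
Qed.

(** Here [c] stands for the real or the imaginary part. *)
Lemma abs_sum_cvg u x (c : R[i] -> R) : (forall z, `|c z| <= normc z) ->
  (abs_sum u x < +oo)%E -> cvgn (series (fun j => c (u j x))).
Proof.
move=> cn Hx; apply: normed_cvg.
have Hfin : abs_sum u x \is a fin_num by rewrite ge0_fin_numE// abs_sum_ge0.
apply: nondecreasing_is_cvgn.
  apply/nondecreasing_seqP => N; rewrite /normed_series_of /series /= big_nat_recr//= lerDl.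
  exact: normr_ge0.
exists (fine (abs_sum u x)) => _ [N _ <-].
rewrite -lee_fin fineK//; apply: le_trans (le_abs_sum u N x).
by rewrite lee_fin; apply: ler_sum => j _; exact: cn.
Qed.

(** The partial sums are dominated by [abs_sum u], a function in L^w, whose product with |f| is
    integrable by Hölder; dominated convergence then yields the pairings. The pointwise clause
    identifies [h] when the sum of the series is known beforehand. *)
Lemma absolutely_summable_rep X (w q : R) (u : nat -> Rn -> R[i]) :
  measurable X -> 1 < w -> 1 < q -> w^-1 + q^-1 = 1 ->
  (forall j, cmeasurable X (u j)) ->
  (\int[mu]_(x in X) (abs_sum u x `^ w) < +oo)%E ->
  exists h, [/\ Lqspace X w h,
    (Lnormc X w h <= (\int[mu]_(x in X) (abs_sum u x `^ w)) `^ w^-1)%E,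
    forall f, Lqspace X q f ->
      (fun N => \sum_(0 <= j < N) cintegral X (fun x => u j x * f x)) @ \oo -->
      (cintegral X (fun x => h x * f x) : R[i]^o) &
    forall x, X x -> (abs_sum u x < +oo)%E ->
      (fun N => \sum_(0 <= j < N) u j x) @ \oo --> (h x : R[i]^o)].
Proof.
move=> mX w1 q1 wq mu' Hw.
have w0 : 0 < w by lra. have q0 : 0 < q by lra.
have mH := measurable_abs_sum mu'.
pose S N x := \sum_(0 <= j < N) u j x.
have mS N : cmeasurable X (S N) by apply: cmeasurable_sum.
(* On [E] the series converges absolutely; off [E], a null part of [X], the sum [h] is set to 0. *)
pose E := X `&` [set x | (abs_sum u x < +oo)%E].
have mE : measurable E by exact: emeasurable_fun_infty_o.
pose h x : R[i] := if x \in E then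
  (limn (series (fun j => cRe (u j x))) +i*
   limn (series (fun j => cIm (u j x))))%C else 0.
have ReS N x : cRe (S N x) = series (fun j => cRe (u j x)) N by rewrite Re_sum.
have ImS N x : cIm (S N x) = series (fun j => cIm (u j x)) N by rewrite Im_sum.
have hr x : x \in E -> (fun N => cRe (S N x)) @ \oo --> cRe (h x).
  move=> xE; rewrite /h xE /=; under eq_fun do rewrite ReS.
  by apply: abs_sum_cvg => [z|]; [exact: Re_le_normc|case/set_mem : xE].
have hi x : x \in E -> (fun N => cIm (S N x)) @ \oo --> cIm (h x).
  move=> xE; rewrite /h xE /=; under eq_fun do rewrite ImS.
  by apply: abs_sum_cvg => [z|]; [exact: Im_le_normc|case/set_mem : xE].
have mh : cmeasurable X h.
  (* Cut down to [E], the partial sums converge at every point of [X], so the limit is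
     measurable. *)
  have aux (c : R[i] -> R) : c 0 = 0 -> (forall N, measurable_fun X (c \o S N)) ->
      (forall x, x \in E -> (fun N => c (S N x)) @ \oo --> c (h x)) ->
      measurable_fun X (c \o h).
    move=> c0 mc hc.
    apply: (@measurable_fun_cvg _ _ _ X (fun N => (c \o S N) \_ E)) => [N|x Xx].
      apply/(measurable_restrict _ mE mX).
      apply: (@measurable_funS _ _ _ _ X) => //; exact: subIsetl.
    have [xE|xE] := boolP (x \in E).
      rewrite (_ : (fun N => _) = (fun N => c (S N x))); first exact: hc.
      by apply/funext => N; rewrite /patch xE.
    rewrite (_ : (fun N => _) = (fun N => 0)); last first.
      by apply/funext => N; rewrite /patch (negbTE xE).
    by rewrite /= /h (negbTE xE) c0; exact: cvg_cst.
  by split; apply: aux => // N; case: (mS N).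
have Sle N x : normc (S N x) <= \sum_(0 <= j < N) normc (u j x) by exact: normc_sum.
have hle x : ((normc (h x))%:E <= abs_sum u x)%E.
  have [xE|xE] := boolP (x \in E); last first.
    by rewrite /h (negbTE xE) Normc.normc0 abs_sum_ge0.
  have Hfin : abs_sum u x \is a fin_num.
    by rewrite ge0_fin_numE ?abs_sum_ge0//; case/set_mem : xE.
  rewrite -(fineK Hfin) lee_fin.
  have cn : (fun N => normc (S N x)) @ \oo --> normc (h x).
    by apply: cvg_normc; [exact: hr|exact: hi].
  rewrite -(cvg_lim _ cn)//; apply: limr_le.
    by apply/cvg_ex; exists (normc (h x)).
  apply: nearW => N; rewrite -lee_fin fineK//.
  by apply: le_trans (le_abs_sum u N x); rewrite lee_fin.
have mHw := measurable_abs_sum_poweR w mu'.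
have powle (a : R) x : 0 <= a -> (a%:E <= abs_sum u x)%E ->
    ((a `^ w)%:E <= abs_sum u x `^ w)%E.
  move=> a0 ax; rewrite -poweR_EFin gt0_ler_poweR ?(ltW w0)//.
  - by rewrite in_itv /= leey lee_fin a0.
  - by rewrite in_itv /= leey abs_sum_ge0.
have hw : (\int[mu]_(x in X) (normc (h x) `^ w)%:E <=
    \int[mu]_(x in X) (abs_sum u x `^ w))%E.
  apply: ge0_le_integral; [exact: mX| |exact: measurable_normc_powR|exact: mHw|].
  - by move=> x _; rewrite lee_fin powR_ge0.
  - by move=> x _; apply: powle => //; exact: normc_ge0.
have wn0 : w != 0 by rewrite gt_eqF.
exists h; split.
- split => //; apply/Lnormc_lty => //; exact: le_lt_trans hw Hw.
- rewrite LnormcE// gt0_ler_poweR ?invr_ge0 ?(ltW w0)//.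
  + by rewrite in_itv /= leey integral_normc_ge0.
  + by rewrite in_itv /= leey andbT integral_ge0// => x _; exact: poweR_ge0.
2: by move=> x Xx Hx; have xE : x \in E;
     [rewrite inE|apply: complex_cvg; [exact: hr|exact: hi]].
move=> f fq; have [mf fq'] := fq.
have uw j : Lqspace X w (u j).
  split => //; apply/Lnormc_lty => //; apply: le_lt_trans Hw.
  apply: ge0_le_integral; [exact: mX| |exact: measurable_normc_powR|exact: mHw|].
  - by move=> x _; rewrite lee_fin powR_ge0.
  - move=> x _; apply: powle; first exact: normc_ge0.
    apply: le_trans (le_abs_sum u j.+1 x); rewrite lee_fin big_nat_recr//= lerDr.
    by apply: sumr_ge0 => i _; exact: normc_ge0.
have SE N : \sum_(0 <= j < N) cintegral X (fun x => u j x * f x) =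
    cintegral X (fun x => S N x * f x).
  have [_ <-] := @cintegral_sum R n X _ (index_iota 0 N) (fun j x => u j x * f x) mX
    (fun j _ => cintegrable_mul mX w0 q0 wq (uw j) fq).
  by congr cintegral; apply/funext => x; rewrite /S mulr_suml.
under eq_fun do rewrite SE.
(* The dominating function. [fine] sends +oo to 0, which happens in [X] only on a null set. *)
pose g x := fine (abs_sum u x) * normc (f x).
have g0 x : 0 <= g x by rewrite mulr_ge0 ?normc_ge0// fine_ge0// abs_sum_ge0.
have mfH : measurable_fun X (fun x => fine (abs_sum u x)).
  by apply: (@measurableT_comp _ _ _ _ _ _ fine _ (abs_sum u)).
have gi : mu.-integrable X (EFin \o g).
  apply/integrableP; split.
    by apply/measurable_EFinP; apply: measurable_funM => //; exact: measurable_normc.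
  rewrite (_ : (\int[mu]_(x in X) _ = \int[mu]_(x in X) (g x)%:E)%E); last first.
    by apply: eq_integral => x _; rewrite /= ger0_norm.
  apply: (integral_mul_lty mX mfH (measurable_normc mf) _ _ w0 q0 wq).
  - by move=> x _; rewrite fine_ge0// abs_sum_ge0.
  - by move=> x _; exact: normc_ge0.
  - apply: le_lt_trans Hw; apply: ge0_le_integral; [exact: mX| | |exact: mHw|].
    + by move=> x _; rewrite lee_fin powR_ge0.
    + apply/measurable_EFinP.
      exact: (@measurableT_comp _ _ _ _ _ _ (fun r : R => r `^ w) _ (fun x => fine (abs_sum u x))).
    + move=> x _; have [->|Hx] := eqVneq (abs_sum u x) +oo%E.
        by rewrite poweRyr// leey.
      apply: powle; first by rewrite fine_ge0// abs_sum_ge0.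
      by rewrite fineK// ge0_fin_numE ?abs_sum_ge0// ltey.
  - by move: fq'; rewrite Lnormc_lty// gt_eqF.
(* An integrable power of [abs_sum u] is finite almost everywhere. *)
have aeE : {ae mu, forall x, X x -> x \in E}.
  have : mu.-integrable X (fun x => abs_sum u x `^ w)%E.
    apply/integrableP; split => //.
    by under eq_integral do rewrite gee0_abs ?poweR_ge0//.
  move=> /(integrable_ae mX); apply: filterS => x Hx Xx.
  rewrite inE; split => //=.
  move: (Hx Xx); rewrite ge0_fin_numE ?poweR_ge0//; exact: lty_poweRy.
have dom (c : R[i] -> R) : (forall z, `|c z| <= normc z) ->
    (forall F, cmeasurable X F -> measurable_fun X (c \o F)) ->
    (forall x, x \in E -> (fun N => c (S N x * f x)) @ \oo --> c (h x * f x)) ->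
    (fun N => \int[mu]_(x in X) c (S N x * f x)) @ \oo -->
      \int[mu]_(x in X) c (h x * f x).
  move=> cn mc hc.
  have mSf N : measurable_fun X (fun x => (c (S N x * f x))%:E).
    by apply/measurable_EFinP; apply: mc; exact: cmeasurableM.
  have mhf : measurable_fun X (fun x => (c (h x * f x))%:E).
    by apply/measurable_EFinP; apply: mc; exact: cmeasurableM.
  have ae1 : {ae mu, forall x, X x ->
      (fun N => (c (S N x * f x))%:E) @ \oo --> (c (h x * f x))%:E}.
    apply: filterS aeE => x /[apply] xE.
    by apply: cvg_EFin; [exact: nearW|exact: hc].
  have ae2 : {ae mu, forall x N, X x -> (`|(c (S N x * f x))%:E| <= (EFin \o g) x)%E}.
    apply: filterS aeE => x xE N /xE {}xE.
    rewrite /= lee_fin; apply: (le_trans (cn _)); rewrite Normc.normcM.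
    rewrite /g ler_wpM2r ?normc_ge0// -lee_fin fineK; last first.
      by rewrite ge0_fin_numE ?abs_sum_ge0//; case/set_mem : xE.
    by apply: le_trans (le_abs_sum u N x); rewrite lee_fin.
  have [ihf _ cv] := dominated_convergence mX mSf mhf ae1 gi ae2.
  apply: fine_cvg; rewrite fineK//; exact: (integrable_fin_num mX ihf).
apply: complex_cvg => /=.
- apply: dom => [z|F [] //|x xE]; first exact: Re_le_normc.
  rewrite Re_mulc; under eq_fun do rewrite Re_mulc.
  by apply: cvgB; apply: cvgMl; [exact: hr|exact: hi].
- apply: dom => [z|F [] //|x xE]; first exact: Im_le_normc.
  rewrite Im_mulc; under eq_fun do rewrite Im_mulc.
  by apply: cvgD; apply: cvgMl; [exact: hr|exact: hi].
Qed.

End LebesguePairing.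

(** * Minkowski's inequality, and duality between L^w and L^q *)

Section MinkowskiInequality.
Context d (T : measurableType d) {R : realType}.
Variable mu : {measure set T -> \bar R}.
Implicit Types (X : set T) (u g : T -> R).

Lemma minkowski_set X u g (p : R) : measurable X ->
  measurable_fun X u -> measurable_fun X g ->
  (forall x, X x -> 0 <= u x) -> (forall x, X x -> 0 <= g x) -> 1 <= p ->
  ((\int[mu]_(x in X) ((u x + g x) `^ p)%:E) `^ p^-1 <=
   (\int[mu]_(x in X) (u x `^ p)%:E) `^ p^-1 +
   (\int[mu]_(x in X) (g x `^ p)%:E) `^ p^-1)%E.
Proof.
move=> mX mU mG u0 g0 p1.
have p0 : 0 < p by exact: lt_le_trans p1.
have E (k : T -> R) : (forall x, X x -> 0 <= k x) -> ('N[mu]_(p%:E)[EFin \o (k \_ X)] =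
    (\int[mu]_(x in X) (k x `^ p)%:E) `^ p^-1)%E.
  move=> k0; rewrite -restrict_EFin Lnorm_patch; last by rewrite gt_eqF.
  apply: (congr1 (fun z => z `^ p^-1)%E).
  by apply: eq_integral => x /set_mem Xx; rewrite ger0_norm ?k0.
have ug0 x : X x -> 0 <= u x + g x by move=> Xx; rewrite addr_ge0 ?u0 ?g0.
have := minkowski_EFin mu ((measurable_restrictT _ mX).1 mU)
  ((measurable_restrictT _ mX).1 mG) p1.
rewrite (_ : (u \_ X) \+ (g \_ X) = (fun x => u x + g x) \_ X); last first.
  by apply/funext => x; rewrite /patch /=; case: ifP => //; rewrite addr0.
by rewrite (E _ u0) (E _ g0) (E _ ug0).
Qed.

End MinkowskiInequality.

Section Minkowski.
Context {R : realType} {n : nat}.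
Local Notation Rn := (n.-tuple R).
Local Notation mu := (@leb R n).
Local Notation normc := (@Normc.normc R).
Local Notation cRe := (@complex.Re R).
Implicit Types (f g h : Rn -> R[i]) (X : set Rn).

Lemma LnormcD X f g (p : R) : measurable X -> cmeasurable X f -> cmeasurable X g ->
  1 <= p ->
  (Lnormc X p (fun x => f x + g x)%R <= Lnormc X p f + Lnormc X p g)%E.
Proof.
move=> mX mf mg p1; have p0 : 0 < p by exact: lt_le_trans p1.
rewrite !LnormcE ?gt_eqF//.
apply: le_trans (minkowski_set mu mX (measurable_normc mf) (measurable_normc mg)
  (fun x _ => normc_ge0 _) (fun x _ => normc_ge0 _) p1).
have S0 x : (0 <= ((normc (f x) + normc (g x)) `^ p)%:E)%E by rewrite lee_fin powR_ge0.
apply: gt0_ler_poweR.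
- by rewrite invr_ge0 ltW.
- by rewrite in_itv /= leey integral_normc_ge0.
- by rewrite in_itv /= leey andbT integral_ge0.
apply: ge0_le_integral; [exact: mX| | | |].
- by move=> x _; rewrite lee_fin powR_ge0.
- by apply: measurable_normc_powR; exact: cmeasurableD.
- apply/measurable_EFinP.
  apply: (@measurableT_comp _ _ _ _ _ _ (fun r : R => r `^ p) _
    (fun x => normc (f x) + normc (g x))) => //.
  by apply: measurable_funD; exact: measurable_normc.
- move=> x _; rewrite lee_fin ge0_ler_powR ?nnegrE ?normc_ge0 ?(ltW p0)//.
    by rewrite addr_ge0 ?normc_ge0.
  exact: le_normcD.
Qed.

Lemma LnormcZ X f (p : R) (k : R[i]) : measurable X -> cmeasurable X f -> 0 < p ->
  Lnormc X p (fun x => k * f x) = ((normc k)%:E * Lnormc X p f)%E.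
Proof.
move=> mX mf p0; rewrite !LnormcE ?gt_eqF//.
have k0 : (0 <= (normc k `^ p)%:E)%E by rewrite lee_fin powR_ge0.
rewrite (_ : (\int[mu]_(x in X) _ =
    (normc k `^ p)%:E * \int[mu]_(x in X) (normc (f x) `^ p)%:E)%E).
  rewrite poweRM ?integral_normc_ge0// poweR_EFin -powRrM mulfV ?gt_eqF//.
  by rewrite powRr1// normc_ge0.
have f0 x : X x -> (0 <= (normc (f x) `^ p)%:E)%E by rewrite lee_fin powR_ge0.
rewrite -(ge0_integralZl _ mX (measurable_normc_powR p mf) f0 k0).
apply: eq_integral => x _; rewrite Normc.normcM powRM ?normc_ge0//.
Qed.

Lemma Lnormc_ge0 X f (p : R) : (0 <= Lnormc X p f)%E.
Proof. exact: Lnorm_ge0. Qed.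

Lemma Lqspace_linear X (p : R) (k : R[i]) f g : measurable X -> 1 <= p ->
  Lqspace X p f -> Lqspace X p g -> Lqspace X p (fun x => k * f x + g x).
Proof.
move=> mX p1 [mf fp] [mg gp]; have p0 : 0 < p by exact: lt_le_trans p1.
have mk : cmeasurable X (fun x => k * f x).
  by apply: cmeasurableM => //; exact: cmeasurable_cst.
split; first exact: cmeasurableD.
apply: (le_lt_trans (LnormcD mX mk mg p1)); rewrite lte_add_pinfty//.
rewrite LnormcZ// lte_mul_pinfty//; first by rewrite lee_fin normc_ge0.
Qed.

(** Minkowski's inequality for a series: the finite case by induction on the partial sums of moduli,
    then monotone convergence of their p-th powers. *)
Lemma abs_sum_Lnormc_le X (p : R) (u : nat -> Rn -> R[i]) : measurable X -> 1 <= p ->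
  (forall j, cmeasurable X (u j)) ->
  ((\int[mu]_(x in X) (abs_sum u x `^ p)) `^ p^-1 <=
   \sum_(j <oo) Lnormc X p (u j))%E.
Proof.
move=> mX p1 mu'; have p0 : 0 < p by exact: lt_le_trans p1.
pose S N x := \sum_(0 <= j < N) normc (u j x).
have S0 N x : 0 <= S N x by apply: sumr_ge0 => j _; exact: normc_ge0.
have mS N : measurable_fun X (S N).
  by apply: measurable_sum => j; exact: measurable_normc.
have mSp N : measurable_fun X (fun x => (S N x `^ p)%:E).
  apply/measurable_EFinP.
  exact: (@measurableT_comp _ _ _ _ _ _ (fun r : R => r `^ p) _ (S N)).
set L := (\sum_(j <oo) _)%E.
have L0 : (0 <= L)%E by apply: nneseries_ge0 => j _ _; exact: Lnormc_ge0.
have SL N : ((\int[mu]_(x in X) (S N x `^ p)%:E) `^ p^-1 <= L)%E.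
  apply: (@le_trans _ _ (\sum_(0 <= j < N) Lnormc X p (u j))%E); last first.
    by apply: nneseries_lim_ge => j _ _; exact: Lnormc_ge0.
  elim: N => [|N IH].
    rewrite big_geq// (_ : (\int[mu]_(x in X) _ = 0)%E) ?poweR0r ?invr_eq0 ?gt_eqF//.
    by apply: integral0_eq => x _; rewrite /S big_geq// powR0 ?gt_eqF.
  rewrite big_nat_recr//=; apply: le_trans (leeD2r _ IH).
  rewrite LnormcE ?gt_eqF//.
  apply: le_trans (minkowski_set mu mX (mS N) (measurable_normc (mu' N))
    (fun x _ => S0 N x) (fun x _ => normc_ge0 _) p1).
  rewrite (_ : (\int[mu]_(x in X) (S N.+1 x `^ p)%:E =
    \int[mu]_(x in X) ((S N x + normc (u N x)) `^ p)%:E)%E); first exact: lexx.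
  by apply: eq_integral => x _; rewrite /S big_nat_recr.
have ndS x : X x -> {homo (fun N => (S N x `^ p)%:E) : N M / (N <= M)%N >-> (N <= M)%E}.
  move=> _ N M NM; rewrite lee_fin ge0_ler_powR ?nnegrE ?(ltW p0)//.
  by rewrite /S (big_cat_nat _ NM)//= lerDl; apply: sumr_ge0 => j _; exact: normc_ge0.
have SpL N : (\int[mu]_(x in X) (S N x `^ p)%:E <= L `^ p)%E.
  rewrite -[leLHS]poweRe1; last by apply: integral_ge0 => x _; rewrite lee_fin powR_ge0.
  rewrite -(mulVf (lt0r_neq0 p0)) poweRrM; apply: gt0_ler_poweR => //.
  - exact: ltW.
  - by rewrite in_itv /= leey poweR_ge0.
  - by rewrite in_itv /= leey L0.
suff HL : (\int[mu]_(x in X) (abs_sum u x `^ p) <= L `^ p)%E.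
  rewrite -[leRHS]poweRe1// -(mulfV (lt0r_neq0 p0)) poweRrM; apply: gt0_ler_poweR.
  - by rewrite invr_ge0 ltW.
  - by rewrite in_itv /= leey andbT integral_ge0// => x _; exact: poweR_ge0.
  - by rewrite in_itv /= leey poweR_ge0.
  - exact: HL.
have Sp0 N x : X x -> (0 <= (S N x `^ p)%:E)%E by rewrite lee_fin powR_ge0.
have cv := @cvg_monotone_convergence _ _ _ mu _ mX _ mSp Sp0 ndS.
apply: (@le_trans _ _ (\int[mu]_(x in X) limn (fun N => (S N x `^ p)%:E))%E).
  apply: ge0_le_integral; [exact: mX| | | |].
  - by move=> x _; exact: poweR_ge0.
  - exact: measurable_abs_sum_poweR.
  - apply: emeasurable_fun_cvg mSp _ => x Xx.
    by apply: ereal_nondecreasing_is_cvgn => N M; exact: ndS.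
  - move=> x Xx; set l := limn _.
    have cvx : cvgn (fun N => (S N x `^ p)%:E).
      by apply: ereal_nondecreasing_is_cvgn => N M; exact: ndS.
    have Sl N : ((S N x `^ p)%:E <= l)%E.
      rewrite /l (cvg_lim _ (ereal_nondecreasing_cvgn (fun A B => ndS x Xx A B)))//.
      by apply: ereal_sup_ubound; exists N.
    have l0 : (0 <= l)%E by apply: le_trans (Sl 0%N); rewrite lee_fin powR_ge0.
    (* Taking roots reduces the claim to a bound on each partial sum, which passes to the supremum
       even where the series diverges. *)
    suff Hl : (abs_sum u x <= l `^ p^-1)%E.
      rewrite -[leRHS]poweRe1// -(mulVf (lt0r_neq0 p0)) poweRrM; apply: gt0_ler_poweR.
      - exact: ltW.
      - by rewrite in_itv /= leey abs_sum_ge0.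
      - by rewrite in_itv /= leey poweR_ge0.
      - exact: Hl.
    apply: lime_le; first by apply: is_cvg_nneseries => j _ _; rewrite lee_fin normc_ge0.
    apply: nearW => N; rewrite sumEFin -/(S N x).
    rewrite -[leLHS]poweRe1 ?lee_fin// -(mulfV (lt0r_neq0 p0)) poweRrM; apply: gt0_ler_poweR.
    - by rewrite invr_ge0 ltW.
    - by rewrite in_itv /= leey lee_fin powR_ge0.
    - by rewrite in_itv /= leey l0.
    - by rewrite poweR_EFin.
rewrite -(cvg_lim _ cv)//; apply: lime_le; first by apply/cvg_ex; eexists; exact: cv.
exact: nearW.
Qed.

(** The test function conj(h) |h|^(w-2) has product |h|^w with [h], and its q-th power has modulus
    |h|^w because (w - 1) q = w; hence it lies in L^q. *)
Lemma Lqspace_eq0 X (w q : R) h : measurable X -> 1 < w -> 1 < q -> w^-1 + q^-1 = 1 ->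
  Lqspace X w h ->
  (forall f, Lqspace X q f -> cintegral X (fun x => h x * f x) = 0) ->
  Lnormc X w h = 0%E.
Proof.
move=> mX w1 q1 wq [mh hw] h0.
have w0 : 0 < w by lra. have q0 : 0 < q by lra.
have wq' : (w - 1) * q = w.
  have wn0 : w != 0 by rewrite gt_eqF.
  have w1n0 : w - 1 != 0 by rewrite subr_eq0 gt_eqF.
  have qV : q^-1 = (w - 1) / w by rewrite mulrBl divff// mul1r -wq addrC addKr.
  by rewrite -[q]invrK qV invf_div mulrC divfK.
move/Lnormc_lty : hw; rewrite gt_eqF// => /(_ isT) hw.
(* The exponent [w - 2] may be negative, but the conjugate factor annihilates [f] wherever [h]
   vanishes. *)
pose f x : R[i] := (h x)^*%C * (normc (h x) `^ (w - 2))%:C%C.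
have nf x : normc (f x) = normc (h x) `^ (w - 1).
  rewrite Normc.normcM normc_conj normc_real ger0_norm ?powR_ge0//.
  rewrite -(mulr_powRB1 (normc_ge0 (h x)) (_ : 0 < w - 1)); last by lra.
  by congr (_ * _ `^ _); lra.
have mf : cmeasurable X f.
  apply: cmeasurableM; first exact: cmeasurable_conj.
  apply: cmeasurable_real.
  apply: (@measurableT_comp _ _ _ _ _ _ (fun r : R => r `^ (w - 2)) _ (fun x => normc (h x))) => //.
  exact: measurable_normc.
have fq : Lqspace X q f.
  split => //; apply/Lnormc_lty; first by rewrite gt_eqF.
  by under eq_integral do rewrite nf -powRrM wq'.
have hf x : cRe (h x * f x) = normc (h x) `^ w.
  rewrite /f mulrA Re_mulc /= mulr0 subr0 ReM_conj expr2 -mulrA.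
  have [->|nz] := eqVneq (normc (h x)) 0; first by rewrite mul0r powR0// gt_eqF.
  rewrite -{1 2}(powRr1 (normc_ge0 (h x))) -!powRD; first by congr (_ `^ _); lra.
    by rewrite nz implybT.
  by rewrite nz implybT.
have := congr1 cRe (h0 f fq); rewrite /cintegral /=.
under eq_Rintegral do rewrite hf.
move=> H; rewrite LnormcE ?gt_eqF//.
have fin : (\int[mu]_(x in X) (normc (h x) `^ w)%:E)%E \is a fin_num.
  by rewrite ge0_fin_numE// integral_normc_ge0.
by rewrite -(fineK fin) [fine _]H poweR0r// invr_eq0 gt_eqF.
Qed.

End Minkowski.

(** * Functionals represented by functions *)

Section ConjugateExponents.
Context {R : realType}.
Implicit Types v w : R.

Lemma conj_expE v : 1 < v -> conj_exp v = v / (v - 1).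
Proof.
move=> v1; rewrite /conj_exp /hoelder_conjugate /= eqe gt_eqF ?(lt_trans _ v1)//.
by rewrite -EFinB inver subr_eq0 gt_eqF.
Qed.

Lemma conj_exp_inv v : 1 < v -> (conj_exp v)^-1 = 1 - v^-1.
Proof.
move=> v1; rewrite conj_expE// invf_div mulrBl divff ?div1r// gt_eqF//.
exact: lt_trans v1.
Qed.

Lemma conj_exp_gt1 v : 1 < v -> 1 < conj_exp v.
Proof.
move=> v1; rewrite conj_expE// ltr_pdivlMr ?subr_gt0// mul1r.
by rewrite ltrBlDr ltrDl.
Qed.

Lemma le_conj_exp v w : 1 < w -> w <= v -> conj_exp v <= conj_exp w.
Proof.
move=> w1 wv; have v1 : 1 < v by exact: lt_le_trans wv.
rewrite -lef_pV2 ?posrE ?(lt_trans _ (conj_exp_gt1 _))// !conj_exp_inv//.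
by rewrite lerD2l lerN2 lef_pV2// posrE; lra.
Qed.

End ConjugateExponents.

Section CubeRestriction.
Context {R : realType} {n : nat}.
Local Notation Rn := (n.-tuple R).
Local Notation mu := (@leb R n).
Local Notation normc := (@Normc.normc R).
Implicit Types (f g h F : Rn -> R[i]) (X A : set Rn) (Q : cube R n).

Lemma cmeasurable_patch X A F : measurable X -> measurable A -> cmeasurable X F ->
  cmeasurable X (fun x => if x \in A then F x else 0).
Proof.
move=> mX mA [m1 m2].
have aux (c : R[i] -> R) : c 0 = 0 -> measurable_fun X (c \o F) ->
    measurable_fun X (c \o (fun x => if x \in A then F x else 0)).
  move=> c0 mc; rewrite (_ : _ \o _ = (c \o F) \_ A).
    apply/(measurable_restrict _ mA mX).
    by apply: (@measurable_funS _ _ _ _ X) => //; exact: subIsetl.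
  by apply/funext => x; rewrite /patch /=; case: ifP.
by split; exact: aux.
Qed.

Lemma cintegral_patch X A F : A `<=` X ->
  cintegral X (fun x => if x \in A then F x else 0) = cintegral A F.
Proof.
move=> AX; rewrite /cintegral; have XA : X `&` A = A by exact/setIidPr.
have aux (c : R[i] -> R) : c 0 = 0 ->
    \int[mu]_(x in X) c (if x \in A then F x else 0) = \int[mu]_(x in A) c (F x).
  move=> c0; rewrite -[in RHS]XA Rintegral_mkcondr; apply: eq_Rintegral => x _.
  by rewrite /patch; case: ifP.
by rewrite !aux.
Qed.

Lemma cintegral_cube_interior Q F : cintegrable (cube_set Q) F ->
  cintegral (cube_set Q) F = cintegral (cube_interior Q) F.
Proof.
move=> [i1 i2]; have mQ := measurable_cube Q; have mI := measurable_cube_interior Q.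
have mB := measurableD mQ mI.
have QE : cube_set Q `\` (cube_set Q `\` cube_interior Q) = cube_interior Q.
  by rewrite setDD; exact/setIidPr/cube_interior_sub.
have B0 := leb_cube_boundary Q.
rewrite /cintegral /Rintegral.
rewrite (negligible_integral mB mQ i1 B0) QE.
by rewrite (negligible_integral mB mQ i2 B0) QE.
Qed.

Lemma powR_Lnormc X f (p : R) : p != 0 ->
  (Lnormc X p f `^ p = \int[mu]_(x in X) (normc (f x) `^ p)%:E)%E.
Proof.
move=> p0; rewrite LnormcE// -poweRrM mulVf// poweRe1//.
exact: integral_normc_ge0.
Qed.

End CubeRestriction.

(** Both sides are the power of the only nonzero term, or 0 if there is none. It is applied at a
    point, which lies in at most one of the disjoint interiors. *)
Lemma poweR_series_single (R : realType) (t : nat -> R) (p : R) : 0 < p ->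
  (forall j, 0 <= t j) -> (forall i j, t i != 0 -> t j != 0 -> i = j) ->
  ((\sum_(j <oo) (t j)%:E) `^ p = \sum_(j <oo) (t j `^ p)%:E)%E.
Proof.
move=> p0 t0 tP; have [[j0 tj0]|t_eq0] := pselect (exists j, t j != 0).
  have tj j : j != j0 -> t j = 0.
    by move=> jj0; apply/eqP/negPn; apply: contra jj0 => tj; apply/eqP/tP.
  rewrite (@sequences.nneseriesD1 _ _ j0)//; last by move=> j _; rewrite lee_fin.
  rewrite eseries0 ?adde0; last by move=> j _ /= /tj ->.
  rewrite (@sequences.nneseriesD1 _ _ j0)//; last by move=> j _; rewrite lee_fin powR_ge0.
  rewrite eseries0 ?adde0; first by rewrite poweR_EFin.
  by move=> j _ /= /tj ->; rewrite powR0// gt_eqF.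
have tj j : t j = 0 by apply/eqP/negPn/negP => tj; apply: t_eq0; exists j.
rewrite eseries0 ?poweR0r ?gt_eqF//; last by move=> j _ _; rewrite tj.
by rewrite eseries0// => j _ _; rewrite tj powR0// gt_eqF.
Qed.

(** * Elements of hk as functions in L^w *)

Section Representation.
Context {R : realType} {n : nat}.
Local Notation Rn := (n.-tuple R).
Local Notation mu := (@leb R n).
Local Notation normc := (@Normc.normc R).
Implicit Types (f h : Rn -> R[i]) (g : @functional R n).
(** [lam] stands for |Q0|^(1/v - 1/w) on a cube and for 1 on the space. [X_fin], [jn_Lq] and
    [coef_sum] isolate what depends on the domain, so that the section serves both cases. *)
Context (X : set Rn) (v w c0 lam : R) (s : nat).
Local Notation p := (conj_exp v).
Local Notation q := (conj_exp w).
Context (mX : measurable X) (w_gt1 : 1 < w) (w_le_v : w <= v)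
  (X_fin : w < v -> (mu X < +oo)%E) (lam_gt0 : 0 < lam)
  (jn_Lq : forall f, jn p q s c0 X f ->
     (Lnormc X q f <= lam%:E * jn_norm p q s c0 X f)%E)
  (coef_sum : forall D Q (l : nat -> R), cube_family X D Q -> (forall j, 0 <= l j) ->
     (\sum_(0 <= j <oo | j \in D) (l j `^ v)%:E < +oo)%E ->
     (\sum_(0 <= j <oo | j \in D) (l j `^ w * vol (Q j) `^ (1 - w / v))%:E <=
     (lam^-1%:E * (\sum_(0 <= j <oo | j \in D) (l j `^ v)%:E) `^ v^-1) `^ w)%E).

Let v_gt1 : 1 < v. Proof. exact: lt_le_trans w_le_v. Qed.
Let p_gt1 : 1 < p. Proof. exact: conj_exp_gt1. Qed.
Let q_gt1 : 1 < q. Proof. exact: conj_exp_gt1. Qed.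
Let w_gt0 : 0 < w. Proof. by rewrite (lt_trans _ w_gt1). Qed.
Let q_gt0 : 0 < q. Proof. by rewrite (lt_trans _ q_gt1). Qed.
Let wq : w^-1 + q^-1 = 1. Proof. by rewrite conj_exp_inv// addrC subrK. Qed.
Let p_le_q : p <= q. Proof. exact: le_conj_exp. Qed.
Let X_fin_pq : p < q -> (mu X < +oo)%E.
Proof.
move=> pq; apply: X_fin; rewrite lt_neqAle w_le_v andbT.
by apply: contraTneq pq => ->; rewrite ltxx.
Qed.

Lemma Lqspace_iff_jn f : Lqspace X q f <-> jn p q s c0 X f.
Proof.
split; first exact: Lqspace_jn.
move=> jf; split; first by case: jf => -[].
apply: (le_lt_trans (jn_Lq jf)); case: jf => _ jf.
by rewrite lte_mul_pinfty// lee_fin ltW.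
Qed.

Definition represents g h :=
  Lqspace X w h /\ forall f, jn p q s c0 X f -> g f = pairing X h f.

(** The difference of two representatives pairs to 0 with all of L^q, so its norm is 0. This makes
    the functions coming from different decompositions of one functional comparable. *)
Lemma represents_norm_le g h1 h2 : represents g h1 -> represents g h2 ->
  (Lnormc X w h1 <= Lnormc X w h2)%E.
Proof.
move=> [L1 r1] [L2 r2].
pose d x := (-1) * h2 x + h1 x.
have Ld : Lqspace X w d by apply: Lqspace_linear => //; exact: ltW.
have d0 : Lnormc X w d = 0%E.
  apply: (Lqspace_eq0 mX w_gt1 q_gt1 wq Ld) => f fq.
  have i1 := cintegrable_mul mX w_gt0 q_gt0 wq L1 fq.
  have i2 := cintegrable_mul mX w_gt0 q_gt0 wq L2 fq.
  have jf := (Lqspace_iff_jn f).1 fq.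
  have := r1 f jf; rewrite (r2 f jf) /pairing => E.
  rewrite (_ : (fun x => d x * f x) = (fun x => (-1) * (h2 x * f x) + h1 x * f x)).
    by rewrite cintegralD ?cintegralZ// ?E ?mulN1r ?addNr//; exact: cintegrableZ.
  by apply/funext => x; rewrite /d mulrDl mulrA.
have := LnormcD mX L2.1 Ld.1 (ltW w_gt1); rewrite d0 adde0; apply: le_trans.
rewrite (_ : (fun x => h2 x + d x) = h1)//.
by apply/funext => x; rewrite /d mulN1r addrA subrr add0r.
Qed.

Lemma represents_norm_eq g h1 h2 : represents g h1 -> represents g h2 ->
  Lnormc X w h1 = Lnormc X w h2.
Proof.
move=> r1 r2; apply/le_anti.
by rewrite (represents_norm_le r1 r2) (represents_norm_le r2 r1).
Qed.

(** Disjointness makes the w-th power of the sum equal to the sum of w-th powers. The size of an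
    atom bounds each integral by |lambda|^w times the volume to the power 1 - w/v, which is the sum
    that [coef_sum] estimates. *)
Lemma atomic_decomp_represents g D l a Q :
  atomic_decomp v w s c0 X g D l a Q -> exists2 h, represents g h &
    (lam%:E * Lnormc X w h <=
     (\sum_(0 <= j <oo | j \in D) (normc (l j) `^ v)%:E) `^ v^-1)%E.
Proof.
move=> [fQ atom lfin gsum].
set V := (\sum_(0 <= j <oo | j \in D) _)%E.
pose F := interior_family D Q.
have mF j : measurable (F j) by exact: measurable_interior_family.
have tF := trivIset_interior_family fQ.
have FQ j : j \in D -> F j = cube_interior (Q j) by rewrite /F /interior_family => ->.
have F0 j : j \notin D -> F j = set0 by rewrite /F /interior_family => /negbTE ->.
have QX j : j \in D -> cube_set (Q j) `<=` X by move=> /set_mem; exact: fQ.1.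
have FX j : j \in D -> F j `<=` X.
  by move=> jD x; rewrite FQ// => /cube_interior_sub /(QX _ jD).
(* Dropping the boundaries makes the supports disjoint at every point; being null, they do not
   affect the pairings. *)
pose u j x := if x \in F j then l j * a j x else 0.
have u_out j : j \notin D -> u j = (fun=> 0).
  by move=> jD; apply/funext => x; rewrite /u F0// in_set0.
have mla j Y : j \in D -> measurable Y -> cmeasurable Y (fun x => l j * a j x).
  move=> /set_mem /atom [ma _ _ _] mY.
  apply: cmeasurableM; first exact: cmeasurable_cst.
  exact: (cmeasurableS measurableT _ ma).
have mu' j : cmeasurable X (u j).
  have [jD|jD] := boolP (j \in D); last by rewrite u_out//; exact: cmeasurable_cst.
  by apply: cmeasurable_patch => //; exact: mla.
have wn0 : w != 0 by rewrite gt_eqF.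
have powE : (\int[mu]_(x in X) (abs_sum u x `^ w) =
    \sum_(j <oo) \int[mu]_(x in X) (normc (u j x) `^ w)%:E)%E.
  rewrite -integral_nneseries//; last 2 first.
  - by move=> j; exact: measurable_normc_powR.
  - by move=> j x _; rewrite lee_fin powR_ge0.
  apply: eq_integral => x _; apply: poweR_series_single => // [j|i j].
    exact: normc_ge0.
  rewrite /u; case: ifPn => [/set_mem xi _|]; last by rewrite Normc.normc0 eqxx.
  case: ifPn => [/set_mem xj _|]; last by rewrite Normc.normc0 eqxx.
  by apply: (tF i j I I); exists x.
have termle j : j \in D -> (\int[mu]_(x in X) (normc (u j x) `^ w)%:E <=
    (normc (l j) `^ w * vol (Q j) `^ (1 - w / v))%:E)%E.
  move=> jD; have mQ := measurable_cube (Q j).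
  have [ma _ an _] := atom j (set_mem jD).
  have XF : X `&` F j = F j by apply/setIidPr; exact: FX.
  rewrite (_ : (\int[mu]_(x in X) _ = \int[mu]_(x in F j) (normc (l j * a j x) `^ w)%:E)%E).
    apply: (@le_trans _ _ (\int[mu]_(x in cube_set (Q j)) (normc (l j * a j x) `^ w)%:E)%E).
      apply: ge0_subset_integral; [exact: mF|exact: mQ| | |].
      - by apply: measurable_normc_powR; exact: mla.
      - by move=> x _; rewrite lee_fin powR_ge0.
      - by rewrite FQ//; exact: cube_interior_sub.
    rewrite -powR_Lnormc// LnormcZ//; last exact: (cmeasurableS measurableT _ ma).
    apply: (@le_trans _ _ (((normc (l j))%:E * (vol (Q j) `^ (w^-1 - v^-1))%:E) `^ w)%E).
      apply: gt0_ler_poweR; first exact: ltW.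
      - by rewrite in_itv /= leey andbT mule_ge0 ?lee_fin ?normc_ge0// Lnormc_ge0.
      - by rewrite in_itv /= leey andbT mule_ge0 ?lee_fin ?normc_ge0// powR_ge0.
      - by rewrite lee_wpmul2l// lee_fin normc_ge0.
    rewrite -EFinM poweR_EFin powRM ?normc_ge0 ?powR_ge0// -powRrM mulrBl mulVf//.
    by rewrite (mulrC v^-1).
  rewrite -XF integral_mkcondr; apply: eq_integral => x _.
  by rewrite /patch /u; case: ifP => //; rewrite Normc.normc0 powR0.
have Hle : (\int[mu]_(x in X) (abs_sum u x `^ w) <= (lam^-1%:E * V `^ v^-1) `^ w)%E.
  rewrite powE; apply: le_trans (coef_sum fQ (fun j => normc_ge0 (l j)) lfin).
  rewrite [leRHS]eseries_mkcond; apply: lee_nneseries => [j _ _|j _].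
    exact: integral_normc_ge0.
  case: ifPn => [|jD]; first exact: termle.
  by rewrite integral0_eq// => x _; rewrite u_out// Normc.normc0 powR0.
have V0 : (0 <= V)%E by apply: nneseries_ge0 => j _ _; rewrite lee_fin powR_ge0.
have lV0 : (0 <= lam^-1%:E * V `^ v^-1)%E.
  by rewrite mule_ge0 ?poweR_ge0// lee_fin invr_ge0 ltW.
have lVoo : (lam^-1%:E * V `^ v^-1 < +oo)%E.
  by rewrite lte_mul_pinfty ?poweR_lty// lee_fin invr_ge0 ltW.
have Hoo : (\int[mu]_(x in X) (abs_sum u x `^ w) < +oo)%E.
  by apply: (le_lt_trans Hle); exact: poweR_lty.
have [h [Lh hle hcv _]] := absolutely_summable_rep mX w_gt1 q_gt1 wq mu' Hoo.
exists h; last first.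
  rewrite -[leRHS]mul1e -(mulfV (lt0r_neq0 lam_gt0)) EFinM -muleA.
  rewrite lee_wpmul2l ?lee_fin ?(ltW lam_gt0)//; apply: (le_trans hle).
  rewrite -[leRHS]poweRe1// -(mulfV wn0) poweRrM; apply: gt0_ler_poweR.
  - by rewrite invr_ge0 ltW.
  - by rewrite in_itv /= leey andbT integral_ge0// => x _; exact: poweR_ge0.
  - by rewrite in_itv /= leey poweR_ge0.
  - exact: Hle.
split=> // f jf; have fq := (Lqspace_iff_jn f).2 jf.
(* [g f] and the pairing with [h] are limits of the same partial sums. *)
apply: (complex_cvg_unique (gsum f jf)).
rewrite (_ : (fun N => _) = (fun N => \sum_(0 <= j < N) cintegral X (fun x => u j x * f x))).
  exact: hcv.
apply/funext => N; rewrite big_mkcond; apply: eq_bigr => j _.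
case: ifPn => jD; last first.
  rewrite u_out// (_ : (fun x => 0 * f x) = (fun=> 0)); last first.
    by apply/funext => x; rewrite mul0r.
  by rewrite /cintegral /= !Rintegral_cst// !mul0r.
have mQ := measurable_cube (Q j).
have [ma _ an _] := atom j (set_mem jD).
have La : Lqspace (cube_set (Q j)) w (a j).
  split; first exact: (cmeasurableS measurableT _ ma).
  by apply: le_lt_trans an _; rewrite ltry.
have fQq : Lqspace (cube_set (Q j)) q f.
  by apply: (Lqspace_sub mQ mX) => //; [rewrite gt_eqF|exact: QX].
have iaf := cintegrable_mul mQ w_gt0 q_gt0 wq La fQq.
rewrite /pairing -cintegralZ// cintegral_cube_interior; last exact: cintegrableZ.
rewrite -FQ// -(cintegral_patch _ (FX _ jD)); congr cintegral; apply/funext => x.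
by rewrite /u; case: ifP; rewrite ?mul0r// mulrA.
Qed.

(** One decomposition supplies [h]; every other one supplies a function of the same norm, so the
    bound survives the infimum. *)
Lemma hk_tilde_represents g : hk_tilde v w s c0 X g -> exists2 h, represents g h &
  (lam%:E * Lnormc X w h <= hk_tilde_norm v w s c0 X g)%E.
Proof.
move=> [_ [D [l [a [Q dec]]]]].
have [h rh _] := atomic_decomp_represents dec; exists h => //.
apply: le_ereal_inf_tmp => _ [D' [l' [a' [Q' [dec' ->]]]]].
have [h' rh' hle] := atomic_decomp_represents dec'.
by rewrite (represents_norm_eq rh rh').
Qed.

(** Representatives of the terms have summable L^w-norms, so Minkowski's inequality for series makes
    their sum absolutely convergent in L^w. *)
Lemma hk_decomp_represents g G : hk_decomp v w s c0 X g G -> exists2 h, represents g h &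
  (lam%:E * Lnormc X w h <= \sum_(0 <= i <oo) hk_tilde_norm v w s c0 X (G i))%E.
Proof.
move=> [tG Gfin gsum].
have /choice[u uP] : forall i, exists h, represents (G i) h /\
    (lam%:E * Lnormc X w h <= hk_tilde_norm v w s c0 X (G i))%E.
  by move=> i; have [h] := hk_tilde_represents (tG i); exists h.
have mu' j : cmeasurable X (u j) by have [[[]]] := uP j.
set L := (\sum_(0 <= i <oo) _)%E in Gfin *.
have sumle : (lam%:E * \sum_(j <oo) Lnormc X w (u j) <= L)%E.
  rewrite -nneseriesZl; last by move=> j _; exact: Lnormc_ge0.
  apply: lee_nneseries => [j _ _|j _]; last by case: (uP j).
  by rewrite mule_ge0 ?Lnormc_ge0// lee_fin ltW.
have sumoo : (\sum_(j <oo) Lnormc X w (u j) < +oo)%E.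
  rewrite -(@lte_pmul2l _ lam%:E) ?lte_fin//.
  rewrite gt0_muley ?lte_fin//; exact: le_lt_trans Gfin.
have mink := abs_sum_Lnormc_le mX (ltW w_gt1) mu'.
have Hoo : (\int[mu]_(x in X) (abs_sum u x `^ w) < +oo)%E.
  have := le_lt_trans mink sumoo; apply: lty_poweRy.
  by rewrite invr_eq0 gt_eqF.
have [h [Lh hle hcv _]] := absolutely_summable_rep mX w_gt1 q_gt1 wq mu' Hoo.
exists h; last first.
  apply: le_trans sumle; rewrite lee_wpmul2l ?lee_fin ?(ltW lam_gt0)//.
  exact: (le_trans hle).
split=> // f jf; apply: (complex_cvg_unique (gsum f jf)).
rewrite (_ : (fun N => _) = (fun N => \sum_(0 <= j < N) cintegral X (fun x => u j x * f x))).
  exact: hcv ((Lqspace_iff_jn f).2 jf).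
apply/funext => N; rewrite big_mkcond; apply: eq_bigr => j _.
by rewrite in_setT; have [[_ ->]] := uP j.
Qed.

Lemma hk_represents g : hk v w s c0 X g -> exists h, represents g h.
Proof. by move=> [_ [G /hk_decomp_represents[h rh _]]]; exists h. Qed.

Lemma hk_norm_ge g h : represents g h ->
  (lam%:E * Lnormc X w h <= hk_norm v w s c0 X g)%E.
Proof.
move=> rh; apply: le_ereal_inf_tmp => _ [G [dec ->]].
have [h' rh' hle] := hk_decomp_represents dec.
by rewrite (represents_norm_eq rh rh').
Qed.

(** Boundedness is Hölder's inequality followed by [jn_Lq]. *)
Lemma represents_jn_dual g h : represents g h -> jn_dual p q s c0 X g.
Proof.
move=> [Lh gE]; split=> [k f1 f2 j1 j2|].
  have q1 := (Lqspace_iff_jn f1).2 j1; have q2 := (Lqspace_iff_jn f2).2 j2.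
  have j3 : jn p q s c0 X (fun x => k * f1 x + f2 x).
    by apply/Lqspace_iff_jn; apply: Lqspace_linear => //; exact: ltW.
  rewrite !gE// /pairing.
  have i1 := cintegrable_mul mX w_gt0 q_gt0 wq Lh q1.
  have i2 := cintegrable_mul mX w_gt0 q_gt0 wq Lh q2.
  rewrite (_ : (fun x => h x * _) = (fun x => k * (h x * f1 x) + h x * f2 x)).
    by rewrite cintegralD ?cintegralZ//; exact: cintegrableZ.
  by apply/funext => x; rewrite mulrDr mulrCA.
have Lfin : Lnormc X w h \is a fin_num by rewrite ge0_fin_numE ?Lnormc_ge0//; case: Lh.
exists (2 * (fine (Lnormc X w h) * lam)) => f jf.
have fq := (Lqspace_iff_jn f).2 jf.
rewrite gE// /pairing EFinM -muleA.
apply: (le_trans (cintegral_mul_le mX w_gt0 q_gt0 wq Lh fq)).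
rewrite lee_wpmul2l// ?lee_fin// EFinM (fineK Lfin) -muleA.
by rewrite lee_wpmul2l ?Lnormc_ge0// jn_Lq.
Qed.

End Representation.

(** * The inclusion of jn in L^q *)

Section Grid.
Context {R : realType} {n : nat}.
Variables (c0 : R) (c0_gt0 : 0 < c0).

(** Left endpoints are included and right endpoints excluded, so that the cubes partition the space
    with no null set left over. *)
Definition grid_cube (z : n.-tuple int) : cube R n :=
  Cube [tuple c0 * (tnth z i)%:~R | i < n] (fun=> true) (fun=> true) c0_gt0.

Lemma grid_cubeP z x : cube_set (grid_cube z) x <->
  forall i, Num.floor (tnth x i / c0) = tnth z i.
Proof.
split=> [zx i|zx i].
  have := zx i; rewrite in_itv /= tnth_mktuple => /andP[h1 h2].
  apply: floor_def; rewrite ler_pdivlMr// ltr_pdivrMr//.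
  by rewrite mulrC h1 intrD mulrDl mul1r mulrC h2.
rewrite in_itv /= tnth_mktuple -(zx i).
have /andP[h1 h2] := floor_itv (tnth x i / c0).
move: h1 h2; rewrite ler_pdivlMr// ltr_pdivrMr// intrD mulrDl mul1r mulrC => -> /=.
by rewrite mulrC.
Qed.

(** The floors of the coordinates divided by [c0] name the cube of a point. Integer tuples are
    enumerated by [pickle], and [D] retains only actual codes, so no cube occurs twice. *)
Lemma grid_exists : exists D (Q : nat -> cube R n),
  [/\ (forall j, side (Q j) = c0), trivIset D (fun j => cube_set (Q j)) &
      \bigcup_(j in D) cube_set (Q j) = setT].
Proof.
pose Q j := grid_cube (odflt [tuple 0 | i < n] (unpickle j)).
have QE z : Q (pickle z) = grid_cube z by rewrite /Q pickleK.
exists [set j | exists z : n.-tuple int, j = pickle z], Q; split => //.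
- move=> _ _ [z ->] [z' ->] [x []]; rewrite !QE => /grid_cubeP zx /grid_cubeP z'x.
  by congr pickle; apply: eq_from_tnth => i; rewrite -zx z'x.
- rewrite -subTset => x _.
  exists (pickle [tuple Num.floor (tnth x i / c0) | i < n]); first by eexists.
  by rewrite QE; apply/grid_cubeP => i; rewrite tnth_mktuple.
Qed.

End Grid.

Lemma nneseries_set1 (R : realType) (u : nat -> \bar R) : (0 <= u 0%N)%E ->
  (\sum_(0 <= j <oo | j \in [set 0%N]) u j = u 0%N)%E.
Proof.
move=> u0; rewrite eseries_mkcond (@sequences.nneseriesD1 _ _ 0%N)//; last first.
  by move=> j _; case: ifPn => // /set_mem ->.
rewrite mem_set// eseries0 ?adde0// => j _ /= j0.
by rewrite memNset//= => /eqP; exact/negP.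
Qed.

Section JNtoLq.
Context {R : realType} {n : nat}.
Local Notation Rn := (n.-tuple R).
Local Notation mu := (@leb R n).
Local Notation normc := (@Normc.normc R).
Implicit Types (f : Rn -> R[i]) (X : set Rn) (Q : cube R n).

Lemma mean_osc_large q s c0 f Q : c0 <= side Q ->
  mean_osc q s c0 f Q = (((vol Q)^-1%:E *
    \int[mu]_(x in cube_set Q) (normc (f x) `^ q)%:E) `^ q^-1)%E.
Proof.
move=> cQ; rewrite /mean_osc /local_moment_proj ltNge cQ /=.
apply: (congr1 (fun z => (((vol Q)^-1%:E * z) `^ q^-1)%E)).
by apply: eq_integral => x _; rewrite polyfun0 subr0.
Qed.

(** The one-member family is admissible for the supremum. Its weight gives the exponent 1/p, and the
    mean inside gives -1/q. *)
Lemma jn_cube_le p q s c0 X f Q : 0 < p -> 0 < q -> c0 <= side Q ->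
  cube_set Q `<=` X -> jn p q s c0 X f ->
  ((vol Q `^ (p^-1 - q^-1))%:E * Lnormc (cube_set Q) q f <= jn_norm p q s c0 X f)%E.
Proof.
move=> p0 q0 cQ QX [[mf floc] _].
have pn0 : p != 0 by rewrite gt_eqF.
have qn0 : q != 0 by rewrite gt_eqF.
have mQ := measurable_cube Q; have V0 := vol_gt0 Q.
have := floc _ mQ QX (bounded_cube Q); rewrite Lnormc_lty// => fq.
have fin : (\int[mu]_(x in cube_set Q) (normc (f x) `^ q)%:E)%E \is a fin_num.
  by rewrite ge0_fin_numE// integral_normc_ge0.
set A := (\int[mu]_(x in cube_set Q) (normc (f x) `^ q)%:E)%E in fq fin.
have A0 : 0 <= fine A by rewrite fine_ge0// integral_normc_ge0.
apply: ereal_sup_ubound; exists [set 0%N], (fun=> Q); split.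
  by split=> [j _|i j /= -> ->].
rewrite nneseries_set1; last by rewrite mule_ge0 ?poweR_ge0// lee_fin ltW.
rewrite mean_osc_large// LnormcE// -/A -(fineK fin).
change ((vol Q `^ (p^-1 - q^-1) * fine A `^ q^-1)%:E =
  ((vol Q * (((vol Q)^-1 * fine A) `^ q^-1) `^ p) `^ p^-1)%:E); congr EFin.
have iV0 : 0 <= (vol Q)^-1 by rewrite invr_ge0 ltW.
rewrite powRM ?powR_ge0 ?(ltW V0)// -!powRrM mulfV// mulr1 powRM// mulrA.
congr (_ * _); rewrite powRB; last by rewrite (gt_eqF V0) implybT.
congr (_ * _); rewrite -(powR_inv1 (ltW V0)) -powRrM mulN1r powRN.
by [].
Qed.

Lemma grid_integral c0 (D : set nat) (Q : nat -> cube R n) (u : Rn -> \bar R) :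
  (forall j, side (Q j) = c0) -> trivIset D (fun j => cube_set (Q j)) ->
  \bigcup_(j in D) cube_set (Q j) = setT ->
  measurable_fun setT u -> (forall x, 0 <= u x)%E ->
  (\int[mu]_x u x = \sum_(0 <= j <oo | j \in D) \int[mu]_(x in cube_set (Q j)) u x)%E.
Proof.
move=> sQ tQ cQ mu' u0.
pose G j := if j \in D then cube_set (Q j) else set0.
have GT : \bigcup_j G j = setT.
  rewrite -cQ; apply/seteqP; split => x [j].
    by rewrite /G; case: ifPn => // /set_mem Dj _ Qx; exists j.
  by move=> Dj Qx; exists j => //; rewrite /G mem_set.
rewrite -GT ge0_integral_bigcup//.
- rewrite [RHS]eseries_mkcond; apply: eq_eseriesr => j _; rewrite /G; case: ifP => // _.
  by rewrite integral_set0.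
- by move=> j; rewrite /G; case: ifP => // _; exact: measurable_cube.
- by rewrite GT.
- move=> i j _ _; rewrite /G.
  case: ifPn => [/set_mem Di|_]; last by case=> x [].
  case: ifPn => [/set_mem Dj|_]; last by case=> x [].
  exact: tQ.
Qed.

Lemma grid_family (D : set nat) (Q : nat -> cube R n) :
  trivIset D (fun j => cube_set (Q j)) -> cube_family setT D Q.
Proof.
move=> tQ; split => // i j Di Dj [x [xi xj]]; apply: tQ => //.
by exists x; split; exact: cube_interior_sub.
Qed.

(** The grid is an admissible family; as both exponents are [p], its cells add up to the whole
    integral. *)
Lemma jn_space_le p s c0 f : 0 < p -> 0 < c0 -> jn p p s c0 setT f ->
  (Lnormc setT p f <= jn_norm p p s c0 setT f)%E.
Proof.
move=> p0 c0_gt0 [[mf _] _].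
have [D [Q [sQ tQ cQ]]] := @grid_exists R n c0 c0_gt0.
apply: ereal_sup_ubound; exists D, Q; split; first exact: grid_family.
rewrite LnormcE ?gt_eqF//; apply: (congr1 (fun z => z `^ p^-1)%E).
rewrite (grid_integral sQ tQ cQ); last 2 first.
- exact: measurable_normc_powR.
- by move=> x; rewrite lee_fin powR_ge0.
apply: eq_eseriesr => j _; rewrite (vol_mean_osc _ _ _ _ p0).
(* Side exactly [c0] already counts as large, so no polynomial is subtracted. *)
rewrite /local_moment_proj sQ ltxx.
by apply: eq_integral => x _; rewrite polyfun0 subr0.
Qed.

End JNtoLq.

(** * Sums of atomic coefficients *)

Section CoefficientSums.
Context {R : realType} {n : nat}.

(** The volumes carry the exponent [1 - v / v = 0], and the two sides agree. *)
Lemma coef_sum_diag v (D : set nat) (Q : nat -> cube R n) (l : nat -> R) : 0 < v ->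
  (\sum_(0 <= j <oo | j \in D) (l j `^ v * vol (Q j) `^ (1 - v / v))%:E <=
   (1^-1%:E * (\sum_(0 <= j <oo | j \in D) (l j `^ v)%:E) `^ v^-1) `^ v)%E.
Proof.
move=> v0; rewrite invr1 mul1e -poweRrM mulVf ?gt_eqF// poweRe1; last first.
  by apply: nneseries_ge0 => j _ _; rewrite lee_fin powR_ge0.
rewrite mulfV ?gt_eqF// subrr.
rewrite (_ : (\sum_(0 <= j <oo | _) (l j `^ v * _)%:E =
   \sum_(0 <= j <oo | j \in D) (l j `^ v)%:E)%E) ?lexx//.
by apply: eq_eseriesr => j _; rewrite powRr0 mulr1.
Qed.

(* Hölder's inequality for series, through Young's inequality for the
   normalized terms. *)
Lemma coef_sum_cube (v w : R) (Q0 : cube R n) (D : set nat) (Q : nat -> cube R n)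
    (l : nat -> R) : 0 < w -> w < v ->
  cube_family (cube_set Q0) D Q -> (forall j, 0 <= l j) ->
  (\sum_(0 <= j <oo | j \in D) (l j `^ v)%:E < +oo)%E ->
  (\sum_(0 <= j <oo | j \in D) (l j `^ w * vol (Q j) `^ (1 - w / v))%:E <=
   ((vol Q0 `^ (v^-1 - w^-1))^-1%:E *
     (\sum_(0 <= j <oo | j \in D) (l j `^ v)%:E) `^ v^-1) `^ w)%E.
Proof.
move=> w0 wv fQ l0 Soo.
have v0 : 0 < v by exact: lt_trans wv.
pose V := vol Q0; have V0 : 0 < V by exact: vol_gt0.
pose th := w / v.
have th0 : 0 < th by rewrite divr_gt0.
have th1 : th < 1 by rewrite ltr_pdivrMr// mul1r.
have lv0 j : (0 <= (l j `^ v)%:E)%E by rewrite lee_fin powR_ge0.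
set S := (\sum_(0 <= j <oo | j \in D) (l j `^ v)%:E)%E in Soo *.
have S0 : (0 <= S)%E by apply: nneseries_ge0.
have Sfin : S \is a fin_num by rewrite ge0_fin_numE.
pose A := fine S; have SE : S = A%:E by rewrite fineK.
have A0 : 0 <= A by exact: fine_ge0.
have VD : (\sum_(0 <= j <oo | j \in D) (vol (Q j))%:E <= V%:E)%E.
  by rewrite -(leb_cubeE Q0); apply: family_vol_le => //; exact: measurable_cube.
rewrite SE -/th.
set LHS := (X in (X <= _)%E).
change (LHS <= (((V `^ (v^-1 - w^-1))^-1 * A `^ v^-1) `^ w)%:E)%E; rewrite {}/LHS.
have -> : ((V `^ (v^-1 - w^-1))^-1 * A `^ v^-1) `^ w = A `^ th * V `^ (1 - th).
  have -> : 1 - th = - (v^-1 - w^-1) * w.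
    by rewrite opprB mulrBl mulVf ?gt_eqF// mulrC.
  by rewrite powRM ?invr_ge0 ?powR_ge0// -powRN -!powRrM [RHS]mulrC /th (mulrC w v^-1).
(* Normalizing divides by [A]; if it is 0, all coefficients in the family are 0. *)
have [A_eq0|An0] := eqVneq A 0.
  rewrite eseries0 ?lee_fin ?mulr_ge0 ?powR_ge0// => j _ jD.
  have : ((l j `^ v)%:E <= S)%E.
    rewrite /S (@sequences.nneseriesD1 _ _ j (fun j => j \in D))//.
    by rewrite leeDl// nneseries_ge0.
  rewrite SE A_eq0 lee_fin => lj.
  have /powR_eq0_eq0 -> : l j `^ v = 0 by apply/le_anti; rewrite lj powR_ge0.
  by rewrite powR0 ?gt_eqF// mul0r.
have Ap : 0 < A by rewrite lt_neqAle eq_sym An0.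
pose K := A `^ th * V `^ (1 - th).
have K0 : 0 <= K by rewrite mulr_ge0 ?powR_ge0.
(* Young's inequality with weights [th] and [1 - th] for the normalized terms [l j ^ v / A] and
   [vol (Q j) / V]. Summed, the right side is at most [K * th + K * (1 - th) = K], the bound
   sought. *)
have term j : l j `^ w * vol (Q j) `^ (1 - th) <=
    K * th / A * l j `^ v + K * (1 - th) / V * vol (Q j).
  have vj := vol_gt0 (Q j).
  have lA : 0 <= l j `^ v / A by rewrite divr_ge0 ?powR_ge0.
  have vV : 0 <= vol (Q j) / V by apply: divr_ge0; exact: ltW.
  have := @conjugate_powR R ((l j `^ v / A) `^ th) ((vol (Q j) / V) `^ (1 - th))
    th^-1 (1 - th)^-1 (powR_ge0 _ _) (powR_ge0 _ _).
  rewrite !invr_gt0 subr_gt0 !invrK addrC subrK => /(_ th0 th1 erefl).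
  rewrite -!powRrM !mulfV ?gt_eqF ?subr_gt0// !powRr1// => Y.
  have -> : l j `^ w * vol (Q j) `^ (1 - th) =
      K * ((l j `^ v / A) `^ th * (vol (Q j) / V) `^ (1 - th)).
    have lw : l j `^ w = (l j `^ v / A) `^ th * A `^ th.
      by rewrite -powRM ?(ltW Ap)// divfK ?gt_eqF// -powRrM /th mulrCA mulfV ?mulr1 ?gt_eqF.
    have vw : vol (Q j) `^ (1 - th) = (vol (Q j) / V) `^ (1 - th) * V `^ (1 - th).
      by rewrite -powRM ?(ltW V0)// divfK ?gt_eqF.
    by rewrite lw vw /K; ring.
  have := ler_wpM2l K0 Y; move=> /le_trans; apply.
  by rewrite le_eqVlt; apply/orP; left; apply/eqP; field; rewrite !gt_eqF.
have a1 : 0 <= K * th / A by apply: divr_ge0; [apply: mulr_ge0 => //|]; exact: ltW.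
have a2 : 0 <= K * (1 - th) / V.
  by apply: divr_ge0; [apply: mulr_ge0 => //; rewrite subr_ge0|]; exact: ltW.
apply: (@le_trans _ _ (\sum_(0 <= j <oo | j \in D)
   ((K * th / A)%:E * (l j `^ v)%:E + (K * (1 - th) / V)%:E * (vol (Q j))%:E))%E).
  apply: lee_nneseries => j *; first by rewrite lee_fin mulr_ge0 ?powR_ge0.
  by rewrite -!EFinM -EFinD lee_fin term.
have v0' j : (0 <= (vol (Q j))%:E)%E by rewrite lee_fin ltW// vol_gt0.
rewrite nneseriesD; last 2 first.
- by move=> j _ _; rewrite mule_ge0// lee_fin.
- by move=> j _ _; rewrite mule_ge0// lee_fin.
rewrite !nneseriesZl; [|by move=> j _..].
rewrite -/S SE; apply: (@le_trans _ _ ((K * th / A)%:E * A%:E + (K * (1 - th) / V)%:E * V%:E)%E).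
  by rewrite leeD2l// lee_wpmul2l// lee_fin.
rewrite -!EFinM -EFinD lee_fin !divfK ?gt_eqF//.
by rewrite -mulrDr addrC subrK mulr1.
Qed.

End CoefficientSums.

(** * Atomic decompositions of functions *)

Section HardyKindMembership.
Context {R : realType} {n : nat}.
Local Notation Rn := (n.-tuple R).
Local Notation normc := (@Normc.normc R).
Implicit Types (f h : Rn -> R[i]) (g : @functional R n) (X : set Rn).

Lemma hk_tilde_norm_ge0 v w s c0 X g : (0 <= hk_tilde_norm v w s c0 X g)%E.
Proof. by apply: le_ereal_inf_tmp => _ [D [l [a [Q [_ ->]]]]]; exact: poweR_ge0. Qed.

Lemma atomic_decomp_zero v w s c0 X (Q : nat -> cube R n) : v != 0 ->
  atomic_decomp v w s c0 X (fun=> 0) set0 (fun=> 0) (fun _ _ => 0) Q.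
Proof.
move=> v0; split.
- by split => [j []|i j []].
- by move=> j [].
- by rewrite eseries0// => j _; rewrite in_set0.
- move=> f _; rewrite (_ : (fun N => _) = (fun=> 0)); first exact: (@cvg_cst R[i]^o).
  by apply/funext => N; apply: big1 => j; rewrite in_set0.
Qed.

(** The empty atomic decomposition; the zero functional pads decompositions in [hk], which are
    indexed by all of [nat]. *)
Lemma hk_tilde_zero v w s c0 X (Q : cube R n) : v != 0 ->
  hk_tilde v w s c0 X (fun=> 0) /\ hk_tilde_norm v w s c0 X (fun=> 0) = 0%E.
Proof.
move=> v0; have dec := atomic_decomp_zero w s c0 X (fun=> Q) v0; split.
  split; last by exists set0, (fun=> 0), (fun _ _ => 0), (fun=> Q).
  split => [k f1 f2 _ _|]; first by rewrite mulr0 addr0.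
  by exists 0 => f _; rewrite Normc.normc0 mul0e.
apply/le_anti; rewrite hk_tilde_norm_ge0 andbT; apply: ereal_inf_lbound.
exists set0, (fun=> 0), (fun _ _ => 0), (fun=> Q); split => //.

by rewrite eseries0 ?poweR0r ?invr_eq0// => j _; rewrite in_set0.
Qed.

(** Through the decomposition g, 0, 0, ... *)
Lemma hk_tilde_hk v w s c0 X g : 0 < v -> hk_tilde v w s c0 X g ->
  hk v w s c0 X g /\ (hk_norm v w s c0 X g <= hk_tilde_norm v w s c0 X g)%E.
Proof.
move=> v0 tg; have vn0 : v != 0 by rewrite gt_eqF.
have [dg [D [l [a [Q dec]]]]] := tg.
have [tz z0] := hk_tilde_zero w s c0 X (Q 0%N) vn0.
pose G (i : nat) : @functional R n := if i == 0%N then g else (fun=> 0).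
have Gsum : (\sum_(0 <= i <oo) hk_tilde_norm v w s c0 X (G i) =
    hk_tilde_norm v w s c0 X g)%E.
  rewrite (@sequences.nneseriesD1 _ _ 0%N)//; last by move=> i _; exact: hk_tilde_norm_ge0.
  rewrite eseries0; first by rewrite adde0 /G eqxx.
  by move=> i _ /= i0; rewrite /G (negbTE i0) z0.
have dG : hk_decomp v w s c0 X g G.
  split.
  - by move=> i; rewrite /G; case: ifP.
  - rewrite Gsum; apply: (@le_lt_trans _ _
      ((\sum_(0 <= j <oo | j \in D) (normc (l j) `^ v)%:E) `^ v^-1)%E).
      by apply: ereal_inf_lbound; exists D, l, a, Q.
    by apply: poweR_lty; case: dec.
  - move=> f _; apply: (@cvg_near_cst _ R[i]^o); exists 1%N => // N /= N0.
    rewrite big_mkcond big_ltn//= in_setT /G eqxx big_nat_cond big1 ?addr0//.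
    by move=> i /andP[/andP[i0 _] _]; rewrite in_setT gtn_eqF.
split; first by split => //; exists G.
by apply: ereal_inf_lbound; exists G.
Qed.

Lemma cmeasurable_patchT (A : set Rn) f : measurable A -> cmeasurable A f ->
  cmeasurable setT (fun x => if x \in A then f x else 0).
Proof.
move=> mA [m1 m2].
have aux (c : R[i] -> R) : c 0 = 0 -> measurable_fun A (c \o f) ->
    measurable_fun setT (c \o (fun x => if x \in A then f x else 0)).
  move=> c0 mc; rewrite (_ : _ \o _ = (c \o f) \_ A).
    exact: (measurable_restrictT _ mA).1.
  by apply/funext => x; rewrite /patch /=; case: ifP.
by split; exact: aux.
Qed.

Lemma eq_Lnormc X (p : R) f h : (forall x, X x -> f x = h x) -> p != 0 ->
  Lnormc X p f = Lnormc X p h.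
Proof.
move=> fh p0; rewrite (LnormcE X f p0) (LnormcE X h p0); apply: (congr1 (fun z => z `^ p^-1)%E).
by apply: eq_integral => x /set_mem Xx; rewrite fh.
Qed.

Lemma eq_cintegral X f h : (forall x, X x -> f x = h x) -> cintegral X f = cintegral X h.
Proof.
by move=> fh; rewrite /cintegral; congr (_ +i* _)%C; apply: eq_Rintegral => x /set_mem Xx;
  rewrite fh.
Qed.

(* For [r = 0] the atom is 0, as [0^-1 = 0]. *)
Lemma local_atom_normalize v w s c0 (Q : cube R n) h (r : R) : 0 < w -> 0 <= r ->
  c0 <= side Q -> Lqspace (cube_set Q) w h ->
  (Lnormc (cube_set Q) w h <= (vol Q `^ (w^-1 - v^-1) * r)%:E)%E ->
  local_atom v w s c0 Q (fun x => if x \in cube_set Q then r^-1%:C%C * h x else 0).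
Proof.
move=> w0 r0 cQ [mh _] hr; have mQ := measurable_cube Q.
have mk : cmeasurable (cube_set Q) (fun x => r^-1%:C%C * h x).
  by apply: cmeasurableM => //; exact: cmeasurable_cst.
split.
- exact: cmeasurable_patchT.
- by move=> x /=; case: ifPn => [/set_mem//|]; rewrite eqxx.
- rewrite (@eq_Lnormc _ _ _ (fun x => r^-1%:C%C * h x)) ?gt_eqF//; last first.
    by move=> x Qx; rewrite mem_set.
  rewrite LnormcZ// normc_real ger0_norm ?invr_ge0//.
  have [->|rn0] := eqVneq r 0; first by rewrite invr0 mul0e lee_fin powR_ge0.
  have rp : 0 < r by rewrite lt_neqAle eq_sym rn0.
  apply: (@le_trans _ _ (r^-1%:E * (vol Q `^ (w^-1 - v^-1) * r)%:E)%E).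
    by rewrite lee_wpmul2l// lee_fin invr_ge0.
  by rewrite -EFinM lee_fin mulrCA mulVf ?mulr1.
- by rewrite ltNge cQ.
Qed.

End HardyKindMembership.

(** * Comparison of the two norms *)

Section Equivalence.
Context {R : realType} {n : nat}.
Local Notation Rn := (n.-tuple R).
Local Notation mu := (@leb R n).
Local Notation normc := (@Normc.normc R).
Implicit Types (f h : Rn -> R[i]) (g : @functional R n).
Context (X : set Rn) (v w c0 lam : R) (s : nat).
Local Notation p := (conj_exp v).
Local Notation q := (conj_exp w).
Context (mX : measurable X) (w_gt1 : 1 < w) (w_le_v : w <= v)
  (X_fin : w < v -> (mu X < +oo)%E) (lam_gt0 : 0 < lam)
  (jn_Lq : forall f, jn p q s c0 X f ->
     (Lnormc X q f <= lam%:E * jn_norm p q s c0 X f)%E)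
  (coef_sum : forall D Q (l : nat -> R), cube_family X D Q -> (forall j, 0 <= l j) ->
     (\sum_(0 <= j <oo | j \in D) (l j `^ v)%:E < +oo)%E ->
     (\sum_(0 <= j <oo | j \in D) (l j `^ w * vol (Q j) `^ (1 - w / v))%:E <=
     (lam^-1%:E * (\sum_(0 <= j <oo | j \in D) (l j `^ v)%:E) `^ v^-1) `^ w)%E).

Let v_gt0 : 0 < v. Proof. by apply: lt_le_trans w_le_v; exact: lt_trans w_gt1. Qed.

(** The lower bound holds for every representative, and an upper bound in [hk_tilde] suffices since
    the norm of [hk] is smaller. The constants are 1, all scaling being contained in [lam]. *)
Lemma hk_equiv_of_atomic_upper :
  (forall g h, represents X v w c0 s g h -> hk_tilde v w s c0 X g /\
     (hk_tilde_norm v w s c0 X g <= lam%:E * Lnormc X w h)%E) ->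
  hk_equiv_Lebesgue v w s c0 X lam 1 1.
Proof.
move=> atomic_upper.
have w_gt0 : 0 < w by exact: lt_trans w_gt1.
have q_gt0 : 0 < q by apply: lt_trans (conj_exp_gt1 w_gt1).
have wq : w^-1 + q^-1 = 1 by rewrite conj_exp_inv// addrC subrK.
have jn_iff := Lqspace_iff_jn mX w_gt1 w_le_v X_fin lam_gt0 jn_Lq.
split.
- move=> h f Lh /jn_iff fq; exact: cintegrable_mul mX w_gt0 q_gt0 wq Lh fq.
- move=> g; split.
    move=> /(hk_represents mX w_gt1 w_le_v X_fin lam_gt0 jn_Lq coef_sum)[h [Lh gh]].
    by exists h.
  move=> [h Lh gh]; have [tg _] := @atomic_upper g h (conj Lh gh).
  by have [] := hk_tilde_hk v_gt0 tg.
- move=> h Lh; have rh : represents X v w c0 s (pairing X h) h by [].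
  rewrite !mul1e; split.
    exact: (hk_norm_ge mX w_gt1 w_le_v X_fin lam_gt0 jn_Lq coef_sum rh).
  have [tg hle] := atomic_upper _ _ rh; apply: le_trans hle.
  by have [] := hk_tilde_hk v_gt0 tg.
Qed.

(** One atom on [Q0], a multiple of [h], with coefficient [lam] times the norm of [h] up to an
    arbitrary [e]. *)
Lemma large_cube_atomic_upper (Q0 : cube R n) g h : X = cube_set Q0 ->
  c0 <= side Q0 -> lam = vol Q0 `^ (v^-1 - w^-1) ->
  represents X v w c0 s g h -> hk_tilde v w s c0 X g /\
  (hk_tilde_norm v w s c0 X g <= lam%:E * Lnormc X w h)%E.
Proof.
move=> XE cQ lamE rh; have [Lh gh] := rh.
have w_gt0 : 0 < w by exact: lt_trans w_gt1.
have Lfin : Lnormc X w h \is a fin_num by rewrite ge0_fin_numE ?Lnormc_ge0//; case: Lh.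
pose N := fine (Lnormc X w h); have NE : Lnormc X w h = N%:E by rewrite fineK.
have N0 : 0 <= N by rewrite fine_ge0// Lnormc_ge0.
have dg := represents_jn_dual mX w_gt1 w_le_v X_fin lam_gt0 jn_Lq rh.
(* The slack [e] keeps the coefficient nonzero even when [h] vanishes almost everywhere, so that it
   cancels against its inverse in the atom. *)
have dec e : 0 < e -> atomic_decomp v w s c0 X g [set 0%N]
    (fun=> (lam * N + e)%:C%C)
    (fun _ x => if x \in cube_set Q0 then (lam * N + e)^-1%:C%C * h x else 0)
    (fun=> Q0).
  move=> e0.
  have r0 : 0 < lam * N + e by rewrite ltr_wpDl// mulr_ge0// ltW.
  split.
  - by split=> [j _|i j /= -> ->]//; rewrite XE.
  - move=> j _; apply: local_atom_normalize => //; first exact: ltW.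
      by rewrite -XE.
    rewrite -XE NE lee_fin mulrDr mulrA.
    (* The volume factor allowed to an atom is the inverse of [lam]. *)
    rewrite lamE -powRD ?(gt_eqF (vol_gt0 Q0)) ?implybT// addrA subrK subrr powRr0 mul1r.
    by rewrite lerDl mulr_ge0 ?powR_ge0// ltW.
  - rewrite nneseries_set1 ?ltry// lee_fin; exact: powR_ge0.
  - move=> f jf; apply: (@cvg_near_cst _ R[i]^o); exists 1%N => // M /= M0.
    rewrite big_mkcond big_ltn//= mem_set// big_nat_cond big1 ?addr0; last first.
      by move=> i /andP[/andP[i0 _] _]; rewrite memNset//= => i_0; rewrite i_0 in i0.
    rewrite gh// /pairing XE.
    have fq := (Lqspace_iff_jn mX w_gt1 w_le_v X_fin lam_gt0 jn_Lq f).2 jf.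
    have q_gt0 : 0 < q by apply: lt_trans (conj_exp_gt1 w_gt1).
    have wq : w^-1 + q^-1 = 1 by rewrite conj_exp_inv// addrC subrK.
    have ihf := cintegrable_mul mX w_gt0 q_gt0 wq Lh fq.
    have mQ := measurable_cube Q0; rewrite XE in ihf.
    rewrite (@eq_cintegral _ _ _ _ (fun x => (lam * N + e)^-1%:C%C * (h x * f x))); last first.
      by move=> x Qx; rewrite mem_set// mulrA.
    rewrite cintegralZ// mulrA -rmorphM mulfV ?gt_eqF//.
    by rewrite mul1r.
split.
  by split => //; do 4 eexists; exact: dec ltr01.
rewrite NE; apply/lee_addgt0Pr => e e0; apply: ereal_inf_lbound.
exists [set 0%N], (fun=> (lam * N + e)%:C%C),
  (fun _ x => if x \in cube_set Q0 then (lam * N + e)^-1%:C%C * h x else 0), (fun=> Q0).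
split; first exact: dec.
have r0 : 0 < lam * N + e by rewrite ltr_wpDl// mulr_ge0// ltW.
rewrite nneseries_set1; last by rewrite lee_fin powR_ge0.
rewrite normc_real ger0_norm ?(ltW r0)// poweR_EFin -powRrM mulfV ?gt_eqF//.
by rewrite powRr1 ?(ltW r0)// -EFinM -EFinD.
Qed.

(** The atom on a cell is [h] divided by its norm there, and that norm is the coefficient; since w =
    v, the v-th powers of the coefficients add up to the integral of |h|^v. *)
Lemma space_atomic_upper g h : X = setT -> w = v -> lam = 1 -> 0 < c0 ->
  represents X v w c0 s g h -> hk_tilde v w s c0 X g /\
  (hk_tilde_norm v w s c0 X g <= lam%:E * Lnormc X w h)%E.
Proof.
move=> XT wv lam1 c0_gt0 rh; have [Lh gh] := rh.
have w_gt0 : 0 < w by exact: lt_trans w_gt1.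
have wn0 : w != 0 by rewrite gt_eqF.
have q_gt1 := conj_exp_gt1 w_gt1.
have q_gt0 : 0 < q by apply: lt_trans q_gt1.
have wq : w^-1 + q^-1 = 1 by rewrite conj_exp_inv// addrC subrK.
have dg := represents_jn_dual mX w_gt1 w_le_v X_fin lam_gt0 jn_Lq rh.
have [D [Q [sQ tQ cQ]]] := @grid_exists R n c0 c0_gt0.
have mQ j := measurable_cube (Q j).
have QX j : cube_set (Q j) `<=` X by rewrite XT.
have LQ j : Lqspace (cube_set (Q j)) w h by exact: (Lqspace_sub _ mX).
pose l j := fine (Lnormc (cube_set (Q j)) w h).
have lE j : Lnormc (cube_set (Q j)) w h = (l j)%:E.
  by rewrite fineK// ge0_fin_numE ?Lnormc_ge0//; case: (LQ j).
have l0 j : 0 <= l j by rewrite fine_ge0// Lnormc_ge0.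
have hint : (\int[mu]_(x in X) (normc (h x) `^ w)%:E < +oo)%E.
  by apply/(Lnormc_lty _ _ wn0); case: Lh.
have mhT : cmeasurable setT h by rewrite -XT; case: Lh.
have sumE : (\sum_(0 <= j <oo | j \in D) (normc (l j)%:C%C `^ v)%:E =
    \int[mu]_(x in X) (normc (h x) `^ w)%:E)%E.
  rewrite XT (grid_integral sQ tQ cQ); last 2 first.
  - exact: measurable_normc_powR.
  - by move=> x; rewrite lee_fin powR_ge0.
  apply: eq_eseriesr => j _.
  by rewrite normc_real ger0_norm// -powR_Lnormc// lE poweR_EFin wv.
pose a j x := if x \in cube_set (Q j) then (l j)^-1%:C%C * h x else 0.
have atom j : local_atom v w s c0 (Q j) (a j).
  apply: local_atom_normalize => //; first by rewrite sQ.
  by rewrite lE wv subrr powRr0 mul1r.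
have grid_sum : wstar_sum p q s c0 X D
    (fun j f => (l j)%:C%C * pairing (cube_set (Q j)) (a j) f) g.
  move=> f jf; rewrite gh// /pairing.
  have fq := (Lqspace_iff_jn mX w_gt1 w_le_v X_fin lam_gt0 jn_Lq f).2 jf.
  (* The pieces of [h] on the cells: their moduli add up to |h| at every point, so the
     representation lemma gives the convergence of the pairings. *)
  pose u j x := if j \in D then if x \in cube_set (Q j) then h x else 0 else 0.
  have mu' j : cmeasurable X (u j).
    rewrite /u; case: (j \in D); last exact: cmeasurable_cst.
    by apply: cmeasurable_patch => //; case: Lh.
  have cell x : exists2 j, D j & u j x = h x /\ forall i, i != j -> u i x = 0.
    have [j Dj Qx] : (\bigcup_(j in D) cube_set (Q j)) x by rewrite cQ.
    exists j => //; split=> [|i ij]; first by rewrite /u (mem_set Dj) (mem_set Qx).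
    rewrite /u; case: ifPn => [|_]; last by []. move=> /set_mem Di.
    case: ifPn => [|_]; last by []. move=> /set_mem Qix.
    by move/negP : ij; case; apply/eqP; apply: (tQ i j Di Dj); exists x.
  have absE x : abs_sum u x = (normc (h x))%:E.
    have [j _ [uj ui]] := cell x.
    rewrite /abs_sum (@sequences.nneseriesD1 _ _ j)//; last first.
      by move=> i _; rewrite lee_fin normc_ge0.
    rewrite eseries0 ?adde0 ?uj// => i _ /= ij.
    by rewrite ui// Normc.normc0.
  have uint : (\int[mu]_(x in X) (abs_sum u x `^ w) < +oo)%E.
    rewrite (_ : (\int[mu]_(x in X) _ = \int[mu]_(x in X) (normc (h x) `^ w)%:E)%E).
      exact: hint.
    by apply: eq_integral => x _; rewrite absE poweR_EFin.
  have [h' [_ _ hcv hlim]] := absolutely_summable_rep mX w_gt1 q_gt1 wq mu' uint.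
  (* The abstract sum is [h] itself: at each point the partial sums are constant once the cell of
     the point has been counted. *)
  have h'E x : X x -> h x = h' x.
    move=> Xx; apply: complex_cvg_unique (hlim x Xx _); last by rewrite absE ltry.
    have [j _ [uj ui]] := cell x.
    apply: (@cvg_near_cst _ R[i]^o); exists j.+1 => // M /= jM.
    rewrite (bigD1_seq j) ?iota_uniq ?mem_index_iota//= uj big1 ?addr0//.
  rewrite (@eq_cintegral _ _ X _ (fun x => h' x * f x)); last by move=> x Xx; rewrite h'E.
  rewrite (_ : (fun N => _) = (fun N => \sum_(0 <= j < N) cintegral X (fun x => u j x * f x))).
    exact: hcv.
  apply/funext => N; rewrite big_mkcond; apply: eq_bigr => j _.
  case: ifPn => jD; last first.
    rewrite (@eq_cintegral _ _ X _ (fun=> 0)); last by move=> x _; rewrite /u (negbTE jD) mul0r.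
    by rewrite /cintegral /= !Rintegral_cst// !mul0r.
  have fQq : Lqspace (cube_set (Q j)) q f by apply: (Lqspace_sub _ mX) => //; rewrite gt_eqF.
  have ihf := cintegrable_mul (mQ j) w_gt0 q_gt0 wq (LQ j) fQq.
  have -> : cintegral X (fun x => u j x * f x) =
      cintegral (cube_set (Q j)) (fun x => h x * f x).
    rewrite -(cintegral_patch _ (QX j)); apply: eq_cintegral => x _.
    by rewrite /u jD; case: ifP; rewrite ?mul0r.
  have -> : cintegral (cube_set (Q j)) (fun x => a j x * f x) =
      (l j)^-1%:C%C * cintegral (cube_set (Q j)) (fun x => h x * f x).
    rewrite -cintegralZ//; apply: eq_cintegral => x Qx.
    by rewrite /a mem_set// mulrA.
  (* On a cell where [h] has norm 0 the coefficient cannot be cancelled, but Hölder makes the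
     integral vanish too. *)
  have [lj0|ljn0] := eqVneq (l j) 0; last first.
    by rewrite mulrA -rmorphM mulfV ?mul1r.
  have := cintegral_mul_le (mQ j) w_gt0 q_gt0 wq (LQ j) fQq.
  rewrite lE lj0 mul0e mule0 lee_fin => z.
  have /Normc.eq0_normc -> : normc (cintegral (cube_set (Q j)) (fun x => h x * f x)) = 0.
    by apply/le_anti; rewrite z normc_ge0.
  by rewrite !mulr0.
have dec : atomic_decomp v w s c0 X g D (fun j => (l j)%:C%C) a Q.
  split => //.
  - by rewrite XT; exact: grid_family.
  - by rewrite sumE.
split; first by split => //; do 4 eexists; exact: dec.
apply: ereal_inf_lbound; exists D, (fun j => (l j)%:C%C), a, Q; split => //.
by rewrite sumE lam1 mul1e LnormcE// wv.
Qed.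

End Equivalence.

Theorem proposition5p6 (R : realType) (n s : nat) (v c0 : R)
    (n_gt0 : (0 < n)%N) (v_gt1 : 1 < v) (c0_gt0 : 0 < c0) :
  (forall w : R, 1 < w -> w <= v ->
     exists c C : R, [/\ 0 < c, 0 < C &
       forall Q0 : cube R n, c0 < side Q0 ->
         hk_equiv_Lebesgue v w s c0 (cube_set Q0)
           (vol Q0 `^ (v^-1 - w^-1)) c C]) /\
  (exists c C : R, [/\ 0 < c, 0 < C &
     hk_equiv_Lebesgue v v s c0 [set: n.-tuple R]%classic 1 c C]).
Proof.
split=> [w w_gt1 wv|].
  exists 1, 1; split => // Q0 cQ0.
  have mQ := measurable_cube Q0; have V0 := vol_gt0 Q0.
  have Qfin : w < v -> (leb n (cube_set Q0) < +oo)%E by rewrite leb_cube ltry.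
  have lam0 : 0 < vol Q0 `^ (v^-1 - w^-1) by exact: powR_gt0.
  have jnL f : jn (conj_exp v) (conj_exp w) s c0 (cube_set Q0) f ->
      (Lnormc (cube_set Q0) (conj_exp w) f <= (vol Q0 `^ (v^-1 - w^-1))%:E *
        jn_norm (conj_exp v) (conj_exp w) s c0 (cube_set Q0) f)%E.
    move=> jf; have p0 : 0 < conj_exp v by apply: lt_trans (conj_exp_gt1 v_gt1).
    have q0 : 0 < conj_exp w by apply: lt_trans (conj_exp_gt1 w_gt1).
    have := jn_cube_le p0 q0 (ltW cQ0) (@subset_refl _ _) jf.
    (* Passing to conjugate exponents reverses the sign of the difference of reciprocals, so the
       volume factor becomes the inverse of [lam]. *)
    rewrite !conj_exp_inv// (_ : 1 - v^-1 - (1 - w^-1) = - (v^-1 - w^-1)); last by ring.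
    by rewrite powRN lee_pdivrMl.
  have coef D Q (l : nat -> R) : cube_family (cube_set Q0) D Q -> (forall j, 0 <= l j) ->
     (\sum_(0 <= j <oo | j \in D) (l j `^ v)%:E < +oo)%E ->
     (\sum_(0 <= j <oo | j \in D) (l j `^ w * vol (Q j) `^ (1 - w / v))%:E <=
      ((vol Q0 `^ (v^-1 - w^-1))^-1%:E *
       (\sum_(0 <= j <oo | j \in D) (l j `^ v)%:E) `^ v^-1) `^ w)%E.
    (* Young's inequality needs w < v; for w = v the factor [lam] is 1 and the diagonal estimate
       applies. *)
    move: wv; rewrite le_eqVlt => /predU1P[->|wv]; last first.
      by apply: coef_sum_cube => //; exact: lt_trans w_gt1.
    by move=> _ _ _; rewrite subrr powRr0; apply: coef_sum_diag; exact: lt_trans v_gt1.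
  apply: (hk_equiv_of_atomic_upper mQ w_gt1 wv Qfin lam0 jnL coef) => g h rh.
  exact: (large_cube_atomic_upper mQ w_gt1 wv Qfin lam0 jnL erefl (ltW cQ0) erefl rh).
exists 1, 1; split => //.
have v_gt0 : 0 < v by exact: lt_trans v_gt1.
have vv : v < v -> (leb n [set: n.-tuple R] < +oo)%E by rewrite ltxx.
have jnL (f : n.-tuple R -> R[i]) : jn (conj_exp v) (conj_exp v) s c0 setT f ->
    (Lnormc setT (conj_exp v) f <= 1%:E * jn_norm (conj_exp v) (conj_exp v) s c0 setT f)%E.
  by move=> jf; rewrite mul1e; apply: jn_space_le => //; apply: lt_trans (conj_exp_gt1 v_gt1).
have coef D (Q : nat -> cube R n) (l : nat -> R) : cube_family setT D Q -> (forall j, 0 <= l j) ->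
   (\sum_(0 <= j <oo | j \in D) (l j `^ v)%:E < +oo)%E ->
   (\sum_(0 <= j <oo | j \in D) (l j `^ v * vol (Q j) `^ (1 - v / v))%:E <=
    (1^-1%:E * (\sum_(0 <= j <oo | j \in D) (l j `^ v)%:E) `^ v^-1) `^ v)%E.
  by move=> _ _ _; exact: coef_sum_diag.
apply: (hk_equiv_of_atomic_upper measurableT v_gt1 (lexx v) vv ltr01 jnL coef) => g h rh.
exact: (space_atomic_upper measurableT v_gt1 (lexx v) vv ltr01 jnL erefl erefl erefl c0_gt0 rh).
Qed.
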